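(* Let $q'$ be a prime power and $q=(q')^{4}$. Then for every odd codimension $r=2t+1\geq 3$ there exists a linear $[n_r,n_r-r]_q$ code $\mathcal{C}_r$ with covering radius $2$ and length $$n_r=\left(2+\frac{2}{\sqrt[4]{q}}+\frac{2}{\sqrt{q}}\right)q^{\frac{r-2}{2}}+\left\lfloor q^{\frac{r-5}{2}}\right\rfloor,$$ and the family satisfies $$\liminf_{r\to\infty}\frac{V_q(n_r,2)}{q^{r}}<2+\frac{4}{\sqrt[4]{q}}+\frac{6}{\sqrt{q}}+\frac{4}{\sqrt[4]{q^{3}}}-\frac{2}{q}-\frac{8}{q\sqrt[4]{q}}.$$
   Context: For a prime power $q$, an $[n,n-r]_q$ code is a linear subspace of $F_q^n$ of dimension $n-r$; it has covering radius $R$ if every column of $F_q^{r}$ is a linear combination of at most $R$ columns of a parity-check matrix, and $R$ is the smallest such integer. $V_q(n,R)=\sum_{i=0}^{R}(q-1)^i\binom{n}{i}$; $V_q(n,R)/q^r$ is the covering density of an $[n,n-r]_qR$ code. *)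

(* Defs.v *)
From HB Require Import structures.
From mathcomp Require Import all_boot all_order all_algebra.
From mathcomp Require Import all_classical all_reals all_analysis.
Set Implicit Arguments.
Unset Strict Implicit.
Unset Printing Implicit Defensive.
Import Order.TTheory GRing.Theory Num.Theory.
Local Open Scope ring_scope.

Definition prime_power (q : nat) : Prop :=
  exists p k : nat, [/\ prime p, (0 < k)%N & q = (p ^ k)%N].

Definition parity_check (F : finFieldType) (n r : nat)
    (C : {vspace 'rV[F]_n}) (H : 'M[F]_(r, n)) : Prop :=
  row_free H /\ forall c : 'rV[F]_n, c \in C <-> H *m c^T = 0.

(* [#|J| <= rho] and zero coefficients being allowed, this is "at most rho
   columns". *)
Definition columns_cover (F : finFieldType) (n r : nat)
    (H : 'M[F]_(r, n)) (rho : nat) : Prop :=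
  forall s : 'cV[F]_r, exists (J : {set 'I_n}) (a : 'I_n -> F),
    (#|J| <= rho)%N /\ s = \sum_(j in J) a j *: col j H.

(* [C] is an [n, n - r] code over [F] with covering radius [rho]. The dimension
   is stated additively to avoid truncated subtraction; the choice of the
   parity-check matrix is immaterial, since any two differ by an invertible
   left factor. *)
Definition covering_code (F : finFieldType) (n r rho : nat)
    (C : {vspace 'rV[F]_n}) : Prop :=
  (\dim C + r = n)%N /\
  exists H : 'M[F]_(r, n),
    [/\ parity_check C H, columns_cover H rho
      & forall rho' : nat, columns_cover H rho' -> (rho <= rho')%N].

Definition ball_volume (q n rho : nat) : nat :=
  (\sum_(0 <= i < rho.+1) (q - 1) ^ i * 'C(n, i))%N.

Definition covering_density (R : realType) (q n r rho : nat) : R :=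
  (ball_volume q n rho)%:R / q%:R ^+ r.

(* Main.v *)
(* Let k < K < F be the fields with q', q'^2, q'^4 elements. A line of PG(2, K)
   meets every subplane of order q' of PG(2, K), and every point of PG(2, F) lies
   on a line of PG(2, K); so the union of two disjoint subplanes of order q', of
   size N = 2 (q'^2 + q' + 1), is 1-saturating in PG(2, F), and every nonzero
   vector of F^3 even is a combination with nonzero coefficients of a point of
   the first and a point of the second.

   To reach F^(3 + 2m), the point h is replaced by the q^m vectors (h, T), where
   T runs over a set lift(S_h) of tensors in F^2 (x) F^m = F^(2m), built from a
   two-dimensional K-subspace S_h of F^2. If h and h' are in different subplanes
   the F-directions of S_h and S_h' are disjoint, and then
   a lift(S_h) + b lift(S_h') is everything: this covers the vectors with nonzero
   component in F^3. The S_h together have all directions of F^2, whence the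
   differences of elements of a common lift(S_h), up to scalars, are everything:
   this covers the vectors with zero component in F^3. The N q^m vectors obtained
   are at most n_r, and zero columns make up the length. *)

Require Import Defs.
From HB Require Import structures.
From mathcomp Require Import all_boot all_order all_algebra.
From mathcomp Require Import all_field.
From mathcomp Require Import all_classical all_reals all_analysis.
From mathcomp Require Import ring lra zify.
Import Order.TTheory GRing.Theory Num.Theory.
Local Open Scope ring_scope.
Set Implicit Arguments.
Unset Strict Implicit.
Unset Printing Implicit Defensive.

(** * Subfields of a finite field, as sets of fixed points *)

(** ['X^q0 - 'X] divides ['X^#|F| - 'X], the product of all ['X - x], so it splits over [F] with
    simple roots. *)
Lemma card_fixed_pow (F : finFieldType) (q0 d : nat) :
  (1 < q0)%N -> (0 < d)%N -> #|F| = (q0 ^ d)%N ->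
  #|[set x : F | x ^+ q0 == x]| = q0.
Proof.
move=> q0_gt1 d_gt0 cardF.
set P : {poly F} := 'X^q0 - 'X.
have sizeP : size P = q0.+1.
  by rewrite /P size_polyDl ?size_polyXn // size_polyN size_polyX.
have dvdP e : P %| 'X^(q0 ^ e.+1) - 'X.
  elim: e => [|e IHe]; first by rewrite expn1 dvdpp.
  have -> : 'X^(q0 ^ e.+2) - 'X = ('X^(q0 ^ e.+1)) ^+ q0 - 'X ^+ q0 + P :> {poly F}.
    by rewrite /P addrA subrK -exprM -expnSr.
  by rewrite dvdp_addl ?dvdpp // subrXX dvdp_mulr.
(* Up to a unit, a divisor of a product of factors ['X - x] is the product over a subsequence, here
   selected by the mask [b]. *)
have [b eqP_b] : {b : bitseq |
    P %= \prod_(x <- mask b (index_enum F)) ('X - x%:P)}.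
  by apply: dvdp_prod_XsubC; rewrite -finField_genPoly cardF -(prednK d_gt0).
have : size P = (size (mask b (index_enum F))).+1.
  by rewrite (eqp_size eqP_b) size_prod_XsubC.
rewrite sizeP => -[size_b]; rewrite [RHS]size_b.
have /card_uniqP <- : uniq (mask b (index_enum F)).
  by rewrite mask_uniq // index_enum_uniq.
apply: eq_card => x; rewrite inE.
have -> : (x \in mask b (index_enum F)) = root P x.
  by rewrite (eqp_root eqP_b) root_prod_XsubC.
by rewrite /root !hornerE subr_eq0.
Qed.

(** Subfields stay subsets of [F], so that vectors over [k], [K] and [F] share one type and [mxOver]
    singles out those with entries in a subfield. *)
Definition subfield_set (F : finFieldType) (k : {set F}) : Prop :=
  [/\ 1 \in k, {in k &, forall x y, x - y \in k}
    & {in k &, forall x y, x / y \in k}].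

(** The iterated Frobenius map is additive and multiplicative. *)
Lemma subfield_fixed_pow (F : finFieldType) (p e : nat) :
  p \in [pchar F] -> subfield_set [set x : F | x ^+ (p ^ e) == x].
Proof.
move=> charp; have nat_pe : [pchar F].-nat (p ^ e)%N.
  rewrite (eq_pnat _ (pcharf_eq charp)) pnatX pnat_id //.
  exact: pcharf_prime charp.
split=> [|x y|x y]; rewrite !inE ?expr1n // => /eqP xk /eqP yk.
  by rewrite exprDn_pchar // exprNn_pchar // xk yk.
by rewrite exprMn exprVn xk yk.
Qed.

Section SubfieldTheory.
Variables (F : finFieldType) (k : {set F}).
Hypothesis k_sub : subfield_set k.

Lemma subfield1 : 1 \in k. Proof. by case: k_sub. Qed.

Lemma subfieldB x y : x \in k -> y \in k -> x - y \in k.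
Proof. by case: k_sub => _ kB _; apply: kB. Qed.

Lemma subfield_div x y : x \in k -> y \in k -> x / y \in k.
Proof. by case: k_sub => _ _ kV; apply: kV. Qed.

Lemma subfield0 : 0 \in k.
Proof. by rewrite -(subrr 1) subfieldB // subfield1. Qed.

Lemma subfieldN x : x \in k -> - x \in k.
Proof. by move=> xk; rewrite -sub0r subfieldB // subfield0. Qed.

Lemma subfieldD x y : x \in k -> y \in k -> x + y \in k.
Proof. by move=> xk yk; rewrite -[y]opprK subfieldB // subfieldN. Qed.

Lemma subfieldM x y : x \in k -> y \in k -> x * y \in k.
Proof.
by move=> xk yk; rewrite -[y]invrK subfield_div // -div1r subfield_div // subfield1.
Qed.

Lemma subfield_mulmx m n p (A : 'M[F]_(m, n)) (B : 'M[F]_(n, p)) :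
  A \is a mxOver k -> B \is a mxOver k -> A *m B \is a mxOver k.
Proof.
move=> /mxOverP Ak /mxOverP Bk; apply/mxOverP => i j; rewrite mxE.
apply: (big_ind (fun x => x \in k)) => [||l _]; first exact: subfield0.
  exact: subfieldD.
exact: subfieldM.
Qed.

Lemma subfield_mxB m n (A B : 'M[F]_(m, n)) :
  A \is a mxOver k -> B \is a mxOver k -> A - B \is a mxOver k.
Proof.
move=> /mxOverP Ak /mxOverP Bk; apply/mxOverP => i j; rewrite !mxE.
exact: subfieldB.
Qed.

Lemma subfield_scalemx m n x (A : 'M[F]_(m, n)) :
  x \in k -> A \is a mxOver k -> x *: A \is a mxOver k.
Proof.
by move=> xk /mxOverP Ak; apply/mxOverP => i j; rewrite !mxE subfieldM.
Qed.

(* [t |-> t ^+ e.+2 - t] takes the value [0] at both [0] and [1], so it is not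
   injective on the finite set [k], hence misses some value of [k]. *)
Lemma subfield_artin_gap e :
  exists2 c, c \in k & forall t, t \in k -> t ^+ e.+2 - t != c.
Proof.
have fk t : t \in k -> t ^+ e.+2 - t \in k.
  move=> tk; apply: subfieldB => //; elim: {e}e.+2 => [|e IHe].
    exact: subfield1.
  by rewrite exprS subfieldM.
have [/fintype.subsetP ksub|/subsetPn[c ck cN]] :=
    boolP (k \subset [set t ^+ e.+2 - t | t in k]).
  have : #|[set t ^+ e.+2 - t | t in k]| == #|k|.
    rewrite eqn_leq leq_imset_card subset_leq_card //; exact/fintype.subsetP.
  move=> /imset_injP/(_ 0 1 subfield0 subfield1).
  rewrite !expr1n expr0n /= !subrr => /(_ erefl)/eqP.
  by rewrite eq_sym oner_eq0.
exists c => // t tk; apply: contraNneq cN => <-.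
exact: imset_f.
Qed.

End SubfieldTheory.

(** * Counting arguments in place of linear algebra over subfields *)

Lemma card_colOver (F : finFieldType) (k : {set F}) n :
  #|[set v : 'cV[F]_n | v \is a mxOver k]| = (#|k| ^ n)%N.
Proof.
rewrite -[in RHS](card_ord n) -card_ffun_on.
pose h (f : {ffun 'I_n -> F}) : 'cV[F]_n := \col_i f i.
have h_inj : injective h.
  by move=> f g /colP eq_fg; apply/ffunP => i; have := eq_fg i; rewrite !mxE.
rewrite -(card_imset _ h_inj); apply: eq_card => v; rewrite inE.
apply/mxOverP/imsetP => [vk|[f /ffun_onP fk -> i j]]; last by rewrite mxE.
exists [ffun i => v i 0]; first by apply/ffun_onP => i; rewrite ffunE.
by apply/colP => i; rewrite mxE ffunE.
Qed.

(** Two elements of [D] share an image, and their difference is the required kernel element. No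
    vector space structure over a subfield has to be set up. *)
Lemma kernel_pigeonhole (V W : finZmodType) (D : {set V}) (E : {set W})
    (f : V -> W) :
  {in D &, forall x y, x - y \in D} -> {morph f : x y / x - y} ->
  {in D, forall x, f x \in E} -> (#|E| < #|D|)%N ->
  exists x, [/\ x \in D, x != 0 & f x = 0].
Proof.
move=> DB fB fE ltED.
have : ~~ [forall x in D, forall y in D, (f x == f y) ==> (x == y)].
  apply: contraL ltED => /'forall_in_forall_inP f_inj; rewrite -leqNgt.
  have /card_in_imset <- : {in D &, injective f}.
    by move=> x y Dx Dy /eqP; move: (f_inj x Dx y Dy) => /implyP/[apply]/eqP.
  by apply/subset_leq_card/fintype.subsetP => _ /imsetP[x Dx ->]; apply: fE.
case/forall_inPn=> x Dx /forall_inPn[y Dy].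
rewrite negb_imply => /andP[/eqP eqf neq_xy].
by exists (x - y); rewrite DB // subr_eq0 fB eqf subrr.
Qed.

(** Two decompositions of one vector differ by an element of both [T] and [U], so addition is
    injective on pairs; by cardinality it is onto. *)
Lemma direct_cover (V : finZmodType) (T U : {set V}) :
  {in T &, forall x y, x - y \in T} -> {in U &, forall x y, x - y \in U} ->
  (forall x, x \in T -> x \in U -> x = 0) -> (#|T| * #|U|)%N = #|V| ->
  forall z, exists t u, [/\ t \in T, u \in U & z = t + u].
Proof.
move=> TB UB TU0 cardTU z.
pose f (x : V * V) := x.1 + x.2.
have f_inj : {in finset.setX T U &, injective f}.
  move=> [t u] [t' u'] /setXP[/= Tt Uu] /setXP[/= Tt' Uu'].
  rewrite /f /= => eqf.
  have eq_diff : t - t' = u' - u.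
    by apply/eqP; rewrite subr_eq addrAC [u' + _]addrC -eqf addrK.
  have : t - t' = 0 by apply: TU0; [apply: TB|rewrite eq_diff; apply: UB].
  move=> /eqP; rewrite subr_eq0 => /eqP eq_t; move: eq_diff.
  by rewrite eq_t subrr => /esym/eqP; rewrite subr_eq0 => /eqP ->.
have : f @: finset.setX T U = [set: V].
  by apply/eqP; rewrite eqEcard finset.subsetT /= card_in_imset // cardsX cardTU cardsT.
move=> /setP/(_ z); rewrite inE => /imsetP[[t u] /setXP[Tt Uu] ->].
by exists t, u.
Qed.

(** The form of the pigeonhole principle used below: [p] equations with values in [E], in [n]
    unknowns from [k]. *)
Lemma subfield_kernel (F : finFieldType) (k E : {set F}) p n (A : 'M[F]_(p, n)) :
  subfield_set k ->
  (forall v : 'cV[F]_n, v \is a mxOver k -> A *m v \is a mxOver E) ->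
  (#|E| ^ p < #|k| ^ n)%N ->
  exists v : 'cV[F]_n, [/\ v \is a mxOver k, v != 0 & A *m v = 0].
Proof.
move=> k_sub AE ltEk.
have [||||v []] := @kernel_pigeonhole _ _
    [set v : 'cV[F]_n | v \is a mxOver k] [set v : 'cV[F]_p | v \is a mxOver E]
    (mulmx A).
- by move=> v w; rewrite !inE; apply: subfield_mxB.
- by move=> v w; rewrite mulmxBr.
- by move=> v; rewrite !inE; apply: AE.
- by rewrite !card_colOver.
- by rewrite inE; exists v.
Qed.

(** * Independence over [F] of vectors from two twisted copies of [k^n] *)

Definition indep (F : fieldType) n (x y : 'cV[F]_n) : Prop :=
  forall a b : F, a *: x + b *: y = 0 -> a = 0 /\ b = 0.

Lemma indep_sym (F : fieldType) n (x y : 'cV[F]_n) : indep x y -> indep y x.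
Proof. by move=> xy a b; rewrite addrC => /xy[]. Qed.

Lemma indep_neq0 (F : fieldType) n (x y : 'cV[F]_n) : indep x y -> x != 0.
Proof.
move=> xy; apply/eqP => x0; have [|/eqP] := xy 1 0.
  by rewrite x0 scaler0 scale0r addr0.
by rewrite oner_eq0.
Qed.

(** The sum [x + th * y] determines [x] and [y], for otherwise [th] would be a quotient of elements
    of [k]; the [#|k| ^ 2] sums therefore exhaust [K]. *)
Lemma subfield_basis (F : finFieldType) (k K : {set F}) (th : F) :
  subfield_set k -> subfield_set K -> {subset k <= K} ->
  #|K| = (#|k| ^ 2)%N -> th \in K -> th \notin k ->
  forall l, l \in K -> exists x y, [/\ x \in k, y \in k & l = x + th * y].
Proof.
move=> k_sub K_sub kK cardK thK thNk l lK.
pose f (x : F * F) := x.1 + th * x.2.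
have f_inj : {in finset.setX k k &, injective f}.
  move=> [x y] [x' y'] /setXP[/= xk yk] /setXP[/= x'k y'k]; rewrite /f /= => eqf.
  have eq_th : th * (y - y') = x' - x.
    apply: (addrI (x + th * y')); rewrite mulrBr.
    rewrite -addrA [th * y' + _]addrC subrK eqf; ring.
  have [eq_y|neq_y] := eqVneq (y - y') 0.
    move: eq_th; rewrite eq_y mulr0 => /esym/eqP.
    by move/eqP: eq_y; rewrite !subr_eq0 => /eqP -> /eqP ->.
  case/negP: thNk; rewrite -[th](mulfK neq_y) eq_th.
  by rewrite subfield_div // subfieldB.
have : f @: finset.setX k k = K.
  apply/eqP; rewrite eqEcard card_in_imset // cardsX cardK mulnn leqnn andbT.
  apply/fintype.subsetP => _ /imsetP[[x y] /setXP[/= xk yk] ->].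
  by rewrite /f /=; apply: (subfieldD K_sub); last apply: (subfieldM K_sub) => //; exact: kK.
move=> /setP/(_ l); rewrite lK => /imsetP[[x y] /setXP[xk yk] ->].
by exists x, y.
Qed.

(* A dependency would read [b + th N b = (x + th y) a] with [x], [y] in [k];
   comparing the coordinates on [1] and [th] makes [b] an eigenvector of [N]. *)
Lemma twisted_indep (F : finFieldType) (k K : {set F}) (th : F) n
    (N : 'M[F]_n) :
  subfield_set k -> subfield_set K -> {subset k <= K} ->
  #|K| = (#|k| ^ 2)%N -> th \in K -> th \notin k ->
  N \is a mxOver k ->
  (forall (b : 'cV[F]_n) m, b \is a mxOver k -> m \in k ->
     N *m b = m *: b -> b = 0) ->
  forall a b : 'cV[F]_n, a \is a mxOver k -> b \is a mxOver k ->
  a != 0 -> b != 0 -> indep a ((1%:M + th *: N) *m b).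
Proof.
move=> k_sub K_sub kK cardK thK thNk Nk noeig a b ak bk a_neq0 b_neq0 al be.
rewrite mulmxDl mul1mx -scalemxAl => dep.
have [be0|be_neq0] := eqVneq be 0.
  move: dep; rewrite be0 scale0r addr0 => /eqP.
  by rewrite scaler_eq0 (negPf a_neq0) orbF => /eqP.
pose l := - al / be.
have eq_l : b + th *: (N *m b) = l *: a.
  apply: (scalerI be_neq0); rewrite scalerA /l mulrC divfK //.
  by apply/eqP; rewrite scaleNr -addr_eq0 addrC dep.
have Nbk : N *m b \is a mxOver k by apply: subfield_mulmx.
(* Read off at a nonzero entry of [a], where both sides of [eq_l] are known to have coefficients in
   [K]. *)
have lK : l \in K.
  have [i ai_neq0] : exists i, a i 0 != 0 by apply/cV0Pn.
  have /matrixP/(_ i 0) := eq_l; rewrite !mxE => eq_i.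
  have entry_K (v : 'cV[F]_n) : v \is a mxOver k -> v i 0 \in K.
    by move=> /mxOverP vk; apply: kK.
  rewrite -[l](mulfK ai_neq0) -eq_i; apply: (subfield_div K_sub); last exact: entry_K.
  apply: (subfieldD K_sub); first exact: entry_K.
  by apply: (subfieldM K_sub) => //; have := entry_K _ Nbk; rewrite mxE.
have [x [y [xk yk def_l]]] := subfield_basis k_sub K_sub kK cardK thK thNk lK.
have Nb : N *m b = y *: a.
  (* A nonzero entry of [N *m b - y *: a] would make [th] a quotient of two elements of [k]. *)
  apply/eqP; rewrite -subr_eq0; apply/negPn/negP => /cV0Pn[i d_neq0].
  case/negP: thNk; rewrite -[th](mulfK d_neq0).
  have /matrixP/(_ i 0) := eq_l; rewrite def_l => eq_i.
  have -> : th * (N *m b - y *: a) i 0 = (x *: a - b) i 0.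
    move: eq_i; rewrite !(mxE, mxE addmx_key, mxE scalemx_key).
    set s := \sum_j _; move=> eq_i.
    have -> : th * (s - y * a i 0) = (b i 0 + th * s) - th * y * a i 0 - b i 0.
      ring.
    rewrite eq_i; ring.
  apply: subfield_div => //.
    have : x *: a - b \is a mxOver k by rewrite subfield_mxB // subfield_scalemx.
    by move/mxOverP.
  have : N *m b - y *: a \is a mxOver k.
    by rewrite subfield_mxB // subfield_scalemx.
  by move/mxOverP.
have eq_b : b = x *: a.
  by apply: (addIr (th *: (N *m b))); rewrite eq_l def_l scalerDl Nb scalerA.
have x_neq0 : x != 0.
  by apply: contraNneq b_neq0 => x0; rewrite eq_b x0 scale0r.
case/eqP: b_neq0; apply: (noeig b (y / x)) => //; first exact: subfield_div.
by rewrite Nb eq_b scalerA divfK.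
Qed.

(** * Saturation of the projective plane by two disjoint subplanes *)

(** The matrix with columns [x], [y], [z] is killed by [w] on the left, hence singular; in a
    dependency the coefficient [c2] of [z] cannot vanish, as [x] and [y] are independent. *)
Lemma plane_spanned (F : fieldType) (w x y z : 'cV[F]_3) :
  w != 0 -> w^T *m x = 0 -> w^T *m y = 0 -> w^T *m z = 0 -> indep x y ->
  exists a b, z = a *: x + b *: y.
Proof.
move=> w_neq0 wx wy wz xy.
pose M : 'M[F]_3 := row_mx x (row_mx y z : 'M[F]_(3, 1 + 1)).
have /eqP/det0P[v v_neq0] : \det M^T = 0.
  rewrite det_tr; apply/eqP/det0P; exists w^T; first by rewrite trmx_eq0.
  have : w^T *m row_mx x (row_mx y z) = 0 by rewrite !mul_mx_row wx wy wz !row_mx0.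
  by [].
move=> /(congr1 trmx); rewrite trmx_mul trmxK trmx0 => Mv.
pose u : 'cV[F]_(1 + (1 + 1)) := v^T.
have def_u : u = col_mx (usubmx u) (col_mx (usubmx (dsubmx u)) (dsubmx (dsubmx u))).
  by rewrite !vsubmxK.
have : row_mx x (row_mx y z) *m u = 0 by [].
rewrite def_u !mul_row_col.
rewrite [usubmx u]mx11_scalar [usubmx (dsubmx u)]mx11_scalar [dsubmx (dsubmx u)]mx11_scalar.
rewrite !mul_mx_scalar.
set c0 := usubmx u 0 0; set c1 := usubmx _ 0 0; set c2 := dsubmx _ 0 0 => dep.
have c2_neq0 : c2 != 0.
  apply: contraNneq v_neq0 => c20; move: dep; rewrite c20 scale0r addr0.
  move=> /xy[c00 c10]; rewrite -trmx_eq0 -/u def_u.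
  rewrite [usubmx u]mx11_scalar [usubmx (dsubmx u)]mx11_scalar [dsubmx (dsubmx u)]mx11_scalar.
  by rewrite -/c0 -/c1 -/c2 c00 c10 c20 !raddf0 !col_mx0.
exists (- (c2^-1 * c0)), (- (c2^-1 * c1)); apply: (scalerI c2_neq0).
rewrite scalerDr !scalerA !mulrN !mulVKf // !scaleNr -opprD.
by apply/eqP; rewrite -addr_eq0 addrC -addrA dep.
Qed.

Section Saturation.
Variables (F : finFieldType) (k K : {set F}).
Hypotheses (k_sub : subfield_set k) (K_sub : subfield_set K).
Hypotheses (kK : {subset k <= K}) (K_gt1 : (1 < #|K|)%N).
Hypotheses (ltFK : (#|F| < #|K| ^ 3)%N) (ltKk : (#|K| < #|k| ^ 3)%N).

Lemma mxOver_sub m n (A : 'M[F]_(m, n)) :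
  A \is a mxOver k -> A \is a mxOver K.
Proof. by move=> /mxOverP Ak; apply/mxOverP => i j; apply: kK. Qed.

(** One equation with values in [K] in three unknowns from [k], and [#|K| < #|k| ^ 3]. *)
Lemma line_meets_subplane (G : 'M[F]_3) (w : 'cV[F]_3) :
  G \is a mxOver K -> w \is a mxOver K ->
  exists b : 'cV[F]_3, [/\ b \is a mxOver k, b != 0 & w^T *m (G *m b) = 0].
Proof.
move=> GK wK; have [||b [bk b_neq0 wGb]] :=
    subfield_kernel (E := K) (A := w^T *m G) k_sub; last 1 first.
- by exists b; rewrite mulmxA.
- move=> v vk; apply: (subfield_mulmx K_sub); last exact: mxOver_sub.
  by apply: (subfield_mulmx K_sub) => //; apply/mxOverP => i j; rewrite mxE (mxOverP wK).
- by rewrite expn1.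
Qed.

(** Join the point [x] of the first subplane to another point [y] of it. The joining line is defined
    over [K], so it meets the second subplane in a point, which differs from [x] and [y] by
    disjointness. This serves the vectors proportional to a single subplane point. *)
Lemma secant_through (G1 G2 : 'M[F]_3) (a : 'cV[F]_3) :
  G1 \is a mxOver K -> G2 \is a mxOver K ->
  (forall a b : 'cV[F]_3, a \is a mxOver k -> b \is a mxOver k ->
     a != 0 -> b != 0 -> indep (G1 *m a) (G2 *m b)) ->
  a \is a mxOver k -> a != 0 ->
  exists (a' b : 'cV[F]_3) (l m : F),
    [/\ a' \is a mxOver k, b \is a mxOver k, a' != 0 & b != 0] /\
    [/\ l != 0, m != 0 & G1 *m a = l *: (G1 *m a') + m *: (G2 *m b)].
Proof.
move=> G1K G2K dis ak a_neq0; set x := G1 *m a.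
have [i xi_neq0] : exists i, x i 0 != 0.
  by apply/cV0Pn; apply: indep_neq0 (dis a a _ _ _ _).
have overK (v : 'cV[F]_3) (G : 'M[F]_3) : G \is a mxOver K ->
    v \is a mxOver k -> G *m v \is a mxOver K.
  by move=> GK vk; apply: (subfield_mulmx K_sub) => //; apply: mxOver_sub.
(* The second point is sought where coordinate [i] vanishes; it differs from [x], whose coordinate
   [i] does not. *)
have [||a' [a'k a'_neq0 row_a']] :=
    subfield_kernel (E := K) (A := row i G1) k_sub.
- move=> v vk; rewrite -row_mul; apply/mxOverP => r s; rewrite mxE.
  exact: (mxOverP (overK _ _ G1K vk)).
- by rewrite expn1.
set y := G1 *m a'.
have yi0 : y i 0 = 0.
  by move/matrixP: row_a' => /(_ 0 0); rewrite -row_mul !mxE.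
have xy : indep x y.
  move=> al be dep; have al0 : al = 0.
    have : al * x i 0 + be * y i 0 = 0.
      by have /matrixP/(_ i 0) := dep; rewrite !mxE.
    by rewrite yi0 mulr0 addr0 => /eqP; rewrite mulf_eq0 (negPf xi_neq0) orbF => /eqP.
  split=> //; move: dep; rewrite al0 scale0r add0r => /eqP.
  rewrite scaler_eq0 => /orP[/eqP //|/eqP y0].
  have := indep_neq0 (dis a' a' a'k a'k a'_neq0 a'_neq0).
  by rewrite -/y y0 eqxx.
(* The equation [w] of the line through [x] and [y]: two conditions on three unknowns, all over
   [K]. *)
have [||w [wK w_neq0 kill]] :=
    subfield_kernel (E := K) (A := (row_mx x y)^T) K_sub.
- move=> v vK; apply: (subfield_mulmx K_sub) => //; rewrite tr_row_mx.
  apply/mxOverP => r s; rewrite mxE; case: splitP => t _; rewrite mxE.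
    exact: (mxOverP (overK _ _ G1K ak)).
  exact: (mxOverP (overK _ _ G1K a'k)).
- by rewrite ltn_exp2l.
move: kill => /(congr1 trmx); rewrite trmx_mul trmxK trmx0 mul_mx_row.
rewrite -[RHS]row_mx0 => /eq_row_mx[wx wy].
have [b [bk b_neq0 wb]] := line_meets_subplane G2K wK.
have [al [be eqz]] := plane_spanned w_neq0 wx wy wb xy.
have be_neq0 : be != 0.
  apply: contraTneq isT => be0; have [|_ /eqP] := dis a b ak bk a_neq0 b_neq0 al (-1).
    by rewrite eqz be0 scale0r addr0 scaleN1r subrr.
  by rewrite oppr_eq0 oner_eq0.
have al_neq0 : al != 0.
  apply: contraTneq isT => al0; have [|_ /eqP] := dis a' b a'k bk a'_neq0 b_neq0 be (-1).
    by rewrite eqz al0 scale0r add0r scaleN1r subrr.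
  by rewrite oppr_eq0 oner_eq0.
exists a', b, (- (be / al)), al^-1; split=> //; split.
- by rewrite oppr_eq0 mulf_neq0 ?invr_neq0.
- by rewrite invr_neq0.
rewrite eqz scalerDr !scalerA mulVf // scale1r addrC scaleNr mulrC.
by rewrite -addrA subrr addr0.
Qed.

(** As [#|F| < #|K| ^ 3], the point [h] lies on a line [w] over [K], which meets both subplanes. If
    a coefficient vanishes, [h] is proportional to a subplane point and [secant_through] replaces
    that point by two others. Both coefficients must be nonzero for [lift_sum_cover]. *)
Lemma two_subplanes_saturate (G1 G2 : 'M[F]_3) (h : 'cV[F]_3) :
  G1 \is a mxOver K -> G2 \is a mxOver K ->
  (forall a b : 'cV[F]_3, a \is a mxOver k -> b \is a mxOver k ->
     a != 0 -> b != 0 -> indep (G1 *m a) (G2 *m b)) ->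
  h != 0 ->
  exists (a b : 'cV[F]_3) (l m : F),
    [/\ a \is a mxOver k, b \is a mxOver k, a != 0 & b != 0] /\
    [/\ l != 0, m != 0 & h = l *: (G1 *m a) + m *: (G2 *m b)].
Proof.
move=> G1K G2K dis h_neq0.
have [||w [wK w_neq0 hw]] :=
    subfield_kernel (E := [set: F]) (A := h^T) K_sub.
- by move=> v _; apply/mxOverP => i j; rewrite inE.
- by rewrite cardsT expn1.
have {hw} wh : w^T *m h = 0.
  by apply: trmx_inj; rewrite trmx_mul trmxK hw trmx0.
have [a [ak a_neq0 wa]] := line_meets_subplane G1K wK.
have [b [bk b_neq0 wb]] := line_meets_subplane G2K wK.
have [l [m eqh]] := plane_spanned w_neq0 wa wb wh (dis a b ak bk a_neq0 b_neq0).
have [m0|m_neq0] := eqVneq m 0.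
  move: eqh; rewrite m0 scale0r addr0 => eqh.
  have l_neq0 : l != 0 by apply: contraNneq h_neq0 => l0; rewrite eqh l0 scale0r.
  have [a' [b' [l' [m' [ab' [l'_neq0 m'_neq0 eqa]]]]]] :=
    secant_through G1K G2K dis ak a_neq0.
  exists a', b', (l * l'), (l * m'); split=> //.
  by rewrite !mulf_neq0 // -!scalerA -scalerDr -eqa.
have [l0|l_neq0] := eqVneq l 0.
  move: eqh; rewrite l0 scale0r add0r => eqh.
  have dis' a' b' a'k b'k a'_neq0 b'_neq0 :=
    indep_sym (dis b' a' b'k a'k b'_neq0 a'_neq0).
  have [b' [a' [m' [l' [[b'k a'k b'_neq0 a'_neq0] [m'_neq0 l'_neq0 eqb]]]]]] :=
    secant_through G2K G1K dis' bk b_neq0.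
  exists a', b', (m * l'), (m * m'); split=> //.
  by rewrite !mulf_neq0 // -!scalerA -scalerDr addrC -eqb.
by exists a, b, l, m.
Qed.

End Saturation.

Definition col3 (F : fieldType) (x y z : F) : 'cV[F]_3 :=
  \col_i [:: x; y; z]`_i.

(** One representative for each point of PG(2, k), with first nonzero coordinate [1]. *)
Definition plane_points (F : finFieldType) (k : {set F}) : seq 'cV[F]_3 :=
  [seq col3 1 x y | x <- enum k, y <- enum k]
    ++ [seq col3 0 1 y | y <- enum k] ++ [:: col3 0 0 1].

Lemma size_plane_points (F : finFieldType) (k : {set F}) :
  size (plane_points k) = (#|k| ^ 2 + #|k| + 1)%N.
Proof.
by rewrite !size_cat size_allpairs size_map -!cardE /= mulnn addnA.
Qed.

Lemma plane_points_normalise (F : finFieldType) (k : {set F}) (v : 'cV[F]_3) :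
  subfield_set k -> v \is a mxOver k -> v != 0 ->
  exists c p, [/\ c != 0, p \in plane_points k & v = c *: p].
Proof.
move=> k_sub /mxOverP vk v_neq0.
pose i0 : 'I_3 := inord 0; pose i1 : 'I_3 := inord 1; pose i2 : 'I_3 := inord 2.
have ord3 (P : 'I_3 -> Prop) : P i0 -> P i1 -> P i2 -> forall i, P i.
  move=> P0 P1 P2 [[|[|[|//]]] lti].
  - by move: P0; congr P; apply: val_inj; rewrite /= inordK.
  - by move: P1; congr P; apply: val_inj; rewrite /= inordK.
  - by move: P2; congr P; apply: val_inj; rewrite /= inordK.
have [x0|x_neq0] := eqVneq (v i0 0) 0; last first.
  exists (v i0 0), (col3 1 (v i1 0 / v i0 0) (v i2 0 / v i0 0)); split=> //.
    rewrite mem_cat; apply/orP; left; apply: allpairs_f;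
      by rewrite mem_enum subfield_div.
  apply/colP; apply: ord3; rewrite !mxE ?inordK //=.
  - by rewrite mulr1.
  - by rewrite mulrC divfK.
  - by rewrite mulrC divfK.
have [y0|y_neq0] := eqVneq (v i1 0) 0; last first.
  exists (v i1 0), (col3 0 1 (v i2 0 / v i1 0)); split=> //.
    rewrite !mem_cat; apply/orP; right; apply/orP; left; apply: map_f.
    by rewrite mem_enum subfield_div.
  apply/colP; apply: ord3; rewrite !mxE ?inordK //=.
  - by rewrite mulr0.
  - by rewrite mulr1.
  - by rewrite mulrC divfK.
exists (v i2 0), (col3 0 0 1); split.
- apply: contraNneq v_neq0 => z0; apply/eqP/colP; apply: ord3; by rewrite mxE.
- by rewrite !mem_cat inE eqxx !orbT.
- apply/colP; apply: ord3; by rewrite !mxE inordK //= ?mulr0 ?mulr1.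
Qed.

(** * Companion matrices without eigenvalues in a subfield *)

Definition rows_mx (F : fieldType) n (s : seq (seq F)) : 'M[F]_n :=
  \matrix_(i, j) (nth [::] s i)`_j.

(* Companion matrices of [X^3 - X - c] and [X^2 - X - c]. *)
Definition companion3 (F : fieldType) (c : F) : 'M[F]_3 :=
  rows_mx 3 [:: [:: 0; 0; c]; [:: 1; 0; 1]; [:: 0; 1; 0]].
Definition companion2 (F : fieldType) (c : F) : 'M[F]_2 :=
  rows_mx 2 [:: [:: 0; c]; [:: 1; 1]].

Lemma companion3_over (F : finFieldType) (k : {set F}) (c : F) :
  subfield_set k -> c \in k -> companion3 c \is a mxOver k.
Proof.
move=> k_sub ck; have [k0 k1] := (subfield0 k_sub, subfield1 k_sub).
by apply/mxOverP => -[[|[|[|//]]] ?] [[|[|[|//]]] ?]; rewrite mxE.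
Qed.

Lemma companion2_over (F : finFieldType) (k : {set F}) (c : F) :
  subfield_set k -> c \in k -> companion2 c \is a mxOver k.
Proof.
move=> k_sub ck; have [k0 k1] := (subfield0 k_sub, subfield1 k_sub).
by apply/mxOverP => -[[|[|//]] ?] [[|[|//]] ?]; rewrite mxE.
Qed.

(** If the last coordinate of an eigenvector is nonzero, elimination gives [m ^+ 3 - m = c]; if it
    is zero, the other two vanish in turn. *)
Lemma companion3_no_eigen (F : finFieldType) (k : {set F}) (c : F) :
  (forall t, t \in k -> t ^+ 3 - t != c) ->
  forall (b : 'cV[F]_3) m, m \in k -> companion3 c *m b = m *: b -> b = 0.
Proof.
move=> no_root b m mk /matrixP Nb.
move: (Nb ord0 0) (Nb (lift ord0 ord0) 0) (Nb (lift ord0 (lift ord0 ord0)) 0).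
rewrite !mxE !big_ord_recl !big_ord0 !mxE /= !(mul0r, mul1r, add0r, addr0).
set b0 := b ord0 0; set b1 := b (@lift 3 ord0 (ord0 : 'I_2)) 0.
set b2 := b (@lift 3 ord0 (@lift 2 ord0 (ord0 : 'I_1))) 0.
move=> e0 e1 e2.
have b20 : b2 = 0.
  apply: contraNeq (no_root m mk) => b2_neq0; apply/eqP/(mulIf b2_neq0).
  have eq_b0 : b0 = m * b1 - b2 by rewrite -e1 addrK.
  rewrite e0 eq_b0 e2; ring.
have b10 : b1 = 0 by rewrite e2 b20 mulr0.
have b00 : b0 = 0 by move: e1; rewrite b20 b10 mulr0 addr0.
apply/colP => i; rewrite mxE.
case: i => [[|[|[|//]]] lti].
- by rewrite -[RHS]b00; congr (b _ _); apply: val_inj.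
- by rewrite -[RHS]b10; congr (b _ _); apply: val_inj.
- by rewrite -[RHS]b20; congr (b _ _); apply: val_inj.
Qed.

Lemma companion2_no_eigen (F : finFieldType) (k : {set F}) (c : F) :
  (forall t, t \in k -> t ^+ 2 - t != c) ->
  forall (b : 'cV[F]_2) m, m \in k -> companion2 c *m b = m *: b -> b = 0.
Proof.
move=> no_root b m mk /matrixP Nb.
move: (Nb ord0 0) (Nb (lift ord0 ord0) 0).
rewrite !mxE !big_ord_recl !big_ord0 !mxE /= !(mul0r, mul1r, add0r, addr0).
set b0 := b ord0 0; set b1 := b (@lift 2 ord0 (ord0 : 'I_1)) 0 => e0 e1.
have b10 : b1 = 0.
  apply: contraNeq (no_root m mk) => b1_neq0; apply/eqP/(mulIf b1_neq0).
  have eq_b0 : b0 = m * b1 - b1 by rewrite -e1 addrK.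
  rewrite e0 eq_b0; ring.
have b00 : b0 = 0 by move: e1; rewrite b10 mulr0 addr0.
apply/colP => i; rewrite mxE.
case: i => [[|[|//]] lti].
- by rewrite -[RHS]b00; congr (b _ _); apply: val_inj.
- by rewrite -[RHS]b10; congr (b _ _); apply: val_inj.
Qed.

(** * Two families of two-dimensional [K]-subspaces of [F^2] *)

Lemma det_mx22 (R : comNzRingType) (A : 'M[R]_2) :
  \det A = A 0 0 * A 1 1 - A 0 1 * A 1 0.
Proof.
rewrite (expand_det_row _ 0) !big_ord_recl big_ord0 addr0 /cofactor !det_mx11.
rewrite !mxE /= expr0 expr1 mul1r mulN1r mulrN.
by congr (A _ _ * A _ _ - A _ _ * A _ _); apply: val_inj.
Qed.

Lemma colP2 (R : nzRingType) (v w : 'cV[R]_2) :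
  v 0 0 = w 0 0 -> v 1 0 = w 1 0 -> v = w.
Proof.
move=> e0 e1; apply/colP => -[[|[|//]] lti].
- by have -> : Ordinal lti = 0 by apply: val_inj.
- by have -> : Ordinal lti = 1 by apply: val_inj.
Qed.

(** Acts on directions by multiplying the slope by [c]. *)
Definition stretch (F : fieldType) (c : F) : 'M[F]_2 :=
  diag_mx (\row_i [:: 1; c]`_i).

Section Stretch.
Variable F : fieldType.
Implicit Types (c d : F) (v : 'cV[F]_2).

Lemma stretch0 c v : (stretch c *m v) 0 0 = v 0 0.
Proof. by rewrite mul_diag_mx !mxE mul1r. Qed.

Lemma stretch1 c v : (stretch c *m v) 1 0 = c * v 1 0.
Proof. by rewrite mul_diag_mx !mxE. Qed.

Lemma stretchM c d v : stretch c *m (stretch d *m v) = stretch (c * d) *m v.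
Proof. by apply: colP2; rewrite ?stretch0 // !stretch1 mulrA. Qed.

Lemma stretch_id v : stretch 1 *m v = v.
Proof. by apply: colP2; rewrite ?stretch0 ?stretch1 ?mul1r. Qed.

Lemma stretch_unit c : c != 0 -> stretch c \in unitmx.
Proof.
move=> c_neq0; rewrite unitmxE det_diag !big_ord_recl big_ord0 !mxE /=.
by rewrite mul1r mulr1 unitfE.
Qed.

Lemma indep_mulmx n (g : 'M[F]_n) (x y : 'cV[F]_n) :
  indep (g *m x) (g *m y) -> indep x y.
Proof.
move=> gxy a b dep; apply: gxy.
by rewrite !scalemxAr -mulmxDr dep mulmx0.
Qed.

Lemma unit_mulmx_eq0 n (g : 'M[F]_n) (x : 'cV[F]_n) :
  g \in unitmx -> (g *m x == 0) = (x == 0).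
Proof.
move=> gU; apply/eqP/eqP => [gx|->]; last by rewrite mulmx0.
by rewrite -(mulKmx gU x) gx mulmx0.
Qed.

End Stretch.

Lemma stretch_over (F : finFieldType) (K : {set F}) (c : F) (v : 'cV[F]_2) :
  subfield_set K -> c \in K -> v \is a mxOver K -> stretch c *m v \is a mxOver K.
Proof.
move=> K_sub cK /mxOverP vK; apply/mxOverP => i j.
rewrite mul_diag_mx !mxE; apply: (subfieldM K_sub) => //.
by case: i => [[|[|//]] ?]; rewrite //= subfield1.
Qed.

(* The quadratic in [th] cannot vanish at [th], [th + 1] and [th + x] for three
   distinct elements [0], [1], [x] of [K]. *)
Lemma twist_generator (F : finFieldType) (K : {set F}) (c : F) :
  subfield_set K -> (2 < #|K|)%N -> (#|K| < #|F|)%N -> c != 0 ->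
  exists th, th \notin K /\ 1 + th - c * th ^+ 2 != 0.
Proof.
move=> K_sub K_gt2 ltKF c_neq0.
have [th thNK] : exists th, th \notin K.
  have : ~~ ([set: F] \subset K).
    by apply: contraL ltKF => /subset_leq_card; rewrite cardsT -leqNgt.
  by case/subsetPn => th _ ?; exists th.
have [x [xK x_neq0 x_neq1]] : exists x, [/\ x \in K, x != 0 & x != 1].
  have : ~~ (K \subset [set 0; 1]).
    by apply: contraL K_gt2 => /subset_leq_card; rewrite cards2 eq_sym oner_neq0 -leqNgt.
  by case/subsetPn => x xK; rewrite !inE negb_or => /andP[? ?]; exists x.
have shift y : y \in K -> th + y \notin K.
  move=> yK; apply: contra thNK => thyK.
  by rewrite -[th](addrK y) (subfieldB K_sub).
have [e0|] := eqVneq (1 + th - c * th ^+ 2) 0; last by exists th.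
have [e1|] := eqVneq (1 + (th + 1) - c * (th + 1) ^+ 2) 0; last first.
  by exists (th + 1); rewrite shift // subfield1.
have [e2|] := eqVneq (1 + (th + x) - c * (th + x) ^+ 2) 0; last first.
  by exists (th + x); rewrite shift.
have d1 : 1 - c * (2 * th + 1) = 0.
  transitivity (1 + (th + 1) - c * (th + 1) ^+ 2 - (1 + th - c * th ^+ 2)).
    ring.
  by rewrite e1 e0 subrr.
have d2 : x * (1 - c * (2 * th + x)) = 0.
  transitivity (1 + (th + x) - c * (th + x) ^+ 2 - (1 + th - c * th ^+ 2)).
    ring.
  by rewrite e2 e0 subrr.
have {d2} d2 : 1 - c * (2 * th + x) = 0.
  by move/eqP: d2; rewrite mulf_eq0 (negPf x_neq0) => /eqP.
have : c * (x - 1) = 0.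
  transitivity (1 - c * (2 * th + 1) - (1 - c * (2 * th + x))); first ring.
  by rewrite d1 d2 subrr.
move/eqP; rewrite mulf_eq0 (negPf c_neq0) subr_eq0 => /eqP x1.
by rewrite x1 eqxx in x_neq1.
Qed.

(** Directions off the axes are sorted by the class of their slope modulo [K^*]. A class whose space
    [stretch c' K^2] shares no direction with [V K^2] contributes that space to [GA]. A class met by
    [V K^2] is swept out by the spaces [stretch x V K^2], [x] in [K^*], which form [GB]. The axes
    belong to [K^2]. *)
Lemma plane_family (F : finFieldType) (K : {set F}) :
  subfield_set K -> (2 < #|K|)%N -> #|F| = (#|K| ^ 2)%N ->
  exists GA GB : seq 'M[F]_2,
    [/\ (0 < size GA <= #|K|.+1)%N, (0 < size GB <= #|K|)%N,
        {in GA ++ GB, forall g, g \in unitmx},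
        (forall gA gB (a b : 'cV[F]_2), gA \in GA -> gB \in GB ->
           a \is a mxOver K -> b \is a mxOver K -> a != 0 -> b != 0 ->
           indep (gA *m a) (gB *m b))
      & forall z : 'cV[F]_2, z != 0 -> exists g b l,
          [/\ g \in GA ++ GB, b \is a mxOver K & z = l *: (g *m b)]].
Proof.
move=> K_sub K_gt2 cardF.
have K0 := subfield0 K_sub; have K1 := subfield1 K_sub.
(* The exponent is [0.+2], so [X^2 - X - c] has no root in [K]. *)
have [c cK no_root] := subfield_artin_gap K_sub 0.
have c_neq0 : c != 0.
  by rewrite eq_sym; move: (no_root 0 K0); rewrite expr0n subr0.
have ltKF : (#|K| < #|F|)%N by rewrite cardF -[ltnLHS]expn1 ltn_exp2l // ltnW.
have [th [thNK det_th]] := twist_generator K_sub K_gt2 ltKF c_neq0.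
have F_sub : subfield_set [set: F] by split=> [|x y _ _|x y _ _]; rewrite inE.
have KF : {subset K <= [set: F]} by move=> x _; rewrite inE.
have cardT : #|[set: F]| = (#|K| ^ 2)%N by rewrite cardsT.
pose V : 'M[F]_2 := 1%:M + th *: companion2 c.
(* The determinant of [V] is the quantity that the choice of [th] made nonzero. *)
have V_unit : V \in unitmx.
  rewrite unitmxE unitfE det_mx22 !mxE /=.
  rewrite (_ : _ - _ = 1 + th - c * th ^+ 2) //; ring.
have V_indep a b : a \is a mxOver K -> b \is a mxOver K -> a != 0 -> b != 0 ->
    indep a (V *m b).
  apply: (twisted_indep K_sub F_sub KF cardT) => //.
    exact: companion2_over.
  by move=> v m _; apply: companion2_no_eigen.
have decF := subfield_basis K_sub F_sub KF cardT (finset.in_setT th) thNK.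
pose good c' := `[< forall a b : 'cV[F]_2, a \is a mxOver K -> b \is a mxOver K ->
   a != 0 -> b != 0 -> indep (stretch c' *m a) (V *m b) >].
have good1 : good 1.
  by apply/asboolP => a b aK bK a0 b0; rewrite stretch_id; apply: V_indep.
(* Representatives of [F^*] modulo [K^*]: a nonzero [x + th * y] is [x] itself or
   [(th + x / y) * y]. *)
pose slopes := 1 :: [seq th + x | x <- enum K].
have slopes_neq0 c' : c' \in slopes -> c' != 0.
  rewrite inE => /predU1P[->|/mapP[x]]; first exact: oner_neq0.
  rewrite mem_enum => xK ->; apply: contra thNK.
  by rewrite addr_eq0 => /eqP ->; apply: subfieldN.
pose GA := [seq stretch c' | c' <- slopes & good c'].
pose GB := [seq stretch x *m V | x <- enum K & x != 0].
have GA_stretch c' : c' \in slopes -> good c' -> stretch c' \in GA.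
  by move=> sc gc; apply: map_f; rewrite mem_filter gc.
have GB_stretch x : x \in K -> x != 0 -> stretch x *m V \in GB.
  move=> xK x0; apply: (map_f (fun x => stretch x *m V)).
  by rewrite mem_filter x0 mem_enum.
have nonempty (s : seq 'M[F]_2) g : g \in s -> (0 < size s)%N by case: s.
exists GA, GB; split.
- rewrite (nonempty _ _ (GA_stretch 1 (mem_head _ _) good1)) /= size_map.
  by rewrite size_filter (leq_trans (count_size _ _)) //= size_map -cardE.
- rewrite (nonempty _ _ (GB_stretch 1 K1 (oner_neq0 _))) /= size_map.
  by rewrite size_filter (leq_trans (count_size _ _)) // -cardE.
- move=> g; rewrite mem_cat => /orP[] /mapP[x]; rewrite mem_filter.
    by case/andP=> _ /slopes_neq0 x0 ->; apply: stretch_unit.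
  by case/andP=> x0 _ ->; rewrite unitmx_mul V_unit stretch_unit.
- move=> _ _ a b /mapP[c' + ->] /mapP[x + ->] aK bK a0 b0.
  rewrite mem_filter => /andP[/asboolP gc _].
  rewrite mem_filter mem_enum => /andP[x0 xK].
  (* Undoing [stretch x] preserves [K^2], as [x] is in [K], and commutes with [stretch c']; this
     reduces to [good c']. *)
  apply: (@indep_mulmx _ _ (stretch x^-1)).
  rewrite -[stretch x *m V *m b]mulmxA !stretchM mulVf // stretch_id mulrC -stretchM.
  apply: gc => //; last by rewrite unit_mulmx_eq0 // stretch_unit // invr_neq0.
  by apply: stretch_over => //; rewrite -div1r subfield_div.
move=> z z_neq0.
have GA1 := GA_stretch 1 (mem_head _ _) good1.
have overK (x y : F) : x \in K -> y \in K -> \col_(i < 2) [:: x; y]`_i \is a mxOver K.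
  by move=> xK yK; apply/mxOverP => -[[|[|//]] ?] j; rewrite mxE.
have [z1_0|z1_neq0] := eqVneq (z 1 0) 0.
  exists (stretch 1), (\col_i [:: 1; 0]`_i), (z 0 0).
  rewrite mem_cat GA1 overK //; split=> //; rewrite stretch_id.
  by apply: colP2; rewrite !mxE /= ?mulr1 ?mulr0.
have [z0_0|z0_neq0] := eqVneq (z 0 0) 0.
  exists (stretch 1), (\col_i [:: 0; 1]`_i), (z 1 0).
  rewrite mem_cat GA1 overK //; split=> //; rewrite stretch_id.
  by apply: colP2; rewrite !mxE /= ?mulr1 ?mulr0.
have [c' [kap [sc' kapK kap_neq0 z1E]]] : exists c' kap,
    [/\ c' \in slopes, kap \in K, kap != 0 & z 1 0 = z 0 0 * (c' * kap)].
  have [x [y [xK yK xyE]]] := decF (z 1 0 / z 0 0) (finset.in_setT _).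
  have slope_neq0 : z 1 0 / z 0 0 != 0 by rewrite mulf_neq0 ?invr_neq0.
  have eqz (u : F) : u = z 1 0 / z 0 0 -> z 1 0 = z 0 0 * u.
    by move=> ->; rewrite mulrC divfK.
  have [y0|y_neq0] := eqVneq y 0.
    exists 1, x; rewrite mem_head; split=> //.
      by apply: contraNneq slope_neq0 => x0; rewrite xyE x0 y0 mulr0 addr0.
    by apply: eqz; rewrite xyE y0 mulr0 addr0 mul1r.
  exists (th + x / y), y; split=> //.
    by rewrite inE map_f ?orbT // mem_enum subfield_div.
  by apply: eqz; rewrite xyE mulrDl divfK // addrC.
have c'_neq0 := slopes_neq0 _ sc'.
have [gc'|] := boolP (good c').
  exists (stretch c'), (\col_i [:: 1; kap]`_i), (z 0 0).
  rewrite mem_cat GA_stretch // overK //; split=> //.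
  by apply: colP2; rewrite [RHS]mxE ?stretch0 ?stretch1 !mxE /= ?mulr1.
move/asboolPn => not_good.
have [a [b [l [[aK bK a_neq0 b_neq0] [l_neq0 VbE]]]]] : exists (a b : 'cV[F]_2) l,
    [/\ a \is a mxOver K, b \is a mxOver K, a != 0 & b != 0] /\
    [/\ l != 0 & V *m b = l *: (stretch c' *m a)].
  apply: contra_notP not_good => none a b aK bK a0 b0 al be dep.
  have [al0|al_neq0] := eqVneq al 0.
    move: dep; rewrite al0 scale0r add0r => /eqP.
    by rewrite scaler_eq0 unit_mulmx_eq0 // (negPf b0) orbF => /eqP.
  have [be0|be_neq0] := eqVneq be 0.
    move: dep; rewrite be0 scale0r addr0 => /eqP.
    by rewrite scaler_eq0 unit_mulmx_eq0 ?stretch_unit // (negPf a0) (negPf al_neq0).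
  case: none; exists a, b, (- (al / be)); split=> //; split.
    by rewrite oppr_eq0 mulf_neq0 ?invr_neq0.
  apply: (scalerI be_neq0); rewrite scalerA mulrN mulrC divfK // scaleNr.
  by apply/eqP; rewrite -addr_eq0 addrC dep.
have Vb0 : (V *m b) 0 0 = l * a 0 0 by rewrite VbE mxE stretch0.
have Vb1 : (V *m b) 1 0 = l * (c' * a 1 0) by rewrite VbE mxE stretch1.
(* Applied to the two unit vectors, this keeps [V *m b] off the axes, so that it has a nonzero
   finite slope. *)
have V_nonaxis (v : 'cV[F]_2) m : v \is a mxOver K -> v != 0 -> V *m b != m *: v.
  move=> vK v0; apply/eqP => Vbv; have [|_ /eqP] := V_indep v b vK bK v0 b_neq0 m (-1).
    by rewrite Vbv scaleN1r subrr.
  by rewrite oppr_eq0 oner_eq0.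
have a0_neq0 : a 0 0 != 0.
  apply: contraTneq isT => a00.
  have e_neq0 : \col_(i < 2) [:: 0; 1]`_i != 0 :> 'cV[F]_2.
    by apply/eqP => /colP/(_ 1)/eqP; rewrite !mxE /= oner_eq0.
  have /eqP[] := V_nonaxis _ (l * (c' * a 1 0)) (overK _ _ K0 K1) e_neq0.
  by apply: colP2; rewrite ?Vb0 ?Vb1 !mxE /= ?a00 ?mulr0 ?mulr1.
have a1_neq0 : a 1 0 != 0.
  apply: contraTneq isT => a10.
  have e_neq0 : \col_(i < 2) [:: 1; 0]`_i != 0 :> 'cV[F]_2.
    by apply/eqP => /colP/(_ 0)/eqP; rewrite !mxE /= oner_eq0.
  have /eqP[] := V_nonaxis _ (l * a 0 0) (overK _ _ K1 K0) e_neq0.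
  by apply: colP2; rewrite ?Vb0 ?Vb1 !mxE /= ?a10 ?mulr0 ?mulr1.
(* [V *m b] has slope [c' * a 1 0 / a 0 0]; stretching by this [x] turns it into [c' * kap], the
   slope of [z]. *)
pose x := kap * (a 0 0 / a 1 0).
have entryK i : a i 0 \in K by apply: (mxOverP aK).
have xK : x \in K by rewrite /x (subfieldM K_sub) ?subfield_div.
have x_neq0 : x != 0 by rewrite /x !mulf_neq0 ?invr_neq0.
exists (stretch x *m V), b, (z 0 0 / (l * a 0 0)).
rewrite mem_cat GB_stretch ?orbT //; split=> //.
apply: colP2; rewrite [RHS]mxE -mulmxA ?stretch0 ?stretch1 ?Vb0 ?Vb1.
  by rewrite divfK // mulf_neq0.
by rewrite z1E /x; field; rewrite a1_neq0 l_neq0 a0_neq0.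
Qed.

(** * Lifting subsets of [F^2] to sets of [2 x m] matrices *)

Lemma indep_solve (F : fieldType) (x y : 'cV[F]_2) m (Z : 'M[F]_(2, m)) :
  indep x y -> exists u v : 'rV[F]_m, Z = x *m u + y *m v.
Proof.
move=> xy; pose M : 'M[F]_2 := row_mx x y.
have MU : M \in unitmx.
  rewrite unitmxE unitfE -det_tr; apply/negP => /det0P[v v_neq0].
  move=> /(congr1 trmx); rewrite trmx_mul trmxK trmx0 => Mv.
  pose u : 'cV[F]_(1 + 1) := v^T.
  have : row_mx x y *m u = 0 by [].
  rewrite -(vsubmxK u) mul_row_col [usubmx u]mx11_scalar [dsubmx u]mx11_scalar.
  rewrite !mul_mx_scalar => /xy[u0 d0].
  case/eqP: v_neq0; apply: trmx_inj; rewrite -/u trmx0 -(vsubmxK u).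
  by rewrite [usubmx u]mx11_scalar [dsubmx u]mx11_scalar u0 d0 !raddf0 col_mx0.
pose W : 'M[F]_(1 + 1, m) := invmx M *m Z.
exists (usubmx W), (dsubmx W).
by rewrite -mul_row_col vsubmxK -[LHS](mulKVmx MU).
Qed.

Lemma indepZ (F : fieldType) n (x y : 'cV[F]_n) (a b : F) :
  a != 0 -> b != 0 -> indep x y -> indep (a *: x) (b *: y).
Proof.
move=> a0 b0 xy c d; rewrite !scalerA => /xy[/eqP + /eqP].
by rewrite !mulf_eq0 (negPf a0) (negPf b0) !orbF => /eqP ? /eqP.
Qed.

(* With [F^2 (x) F^m] identified with the [2 x m] matrices, [lift S m] consists
   of the tensors [s (x) e] with [s \in S] and [e] a vector whose first nonzero
   entry is [1]. *)
Fixpoint lift_set (F : finFieldType) (S : {set 'cV[F]_2}) m :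
    {set 'M[F]_(2, m)} :=
  if m is m'.+1 then
    [set (row_mx p.1 (p.1 *m p.2) : 'M[F]_(2, 1 + m'))
      | p in finset.setX (S :\ 0) [set: 'rV[F]_m']]
    :|: [set (row_mx 0 Z : 'M[F]_(2, 1 + m')) | Z in lift_set S m']
  else [set 0].

(* The block matrix identities, restated at the width [m.+1] so that they can be
   rewritten with in spite of [1 + m] being only convertible to [m.+1]. *)
Section RowMxS.
Variables (F : fieldType) (n m : nat).
Implicit Types (A : 'cV[F]_n) (B : 'M[F]_(n, m)).
Let blk A B : 'M[F]_(n, m.+1) := row_mx A B.

Lemma scale_row_mxS c A B : c *: blk A B = blk (c *: A) (c *: B).
Proof. exact: (@scale_row_mx F n 1 m). Qed.

Lemma add_row_mxS A B A' B' : blk A B + blk A' B' = blk (A + A') (B + B').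
Proof. exact: (@add_row_mx F n 1 m). Qed.

Lemma opp_row_mxS A B : - blk A B = blk (- A) (- B).
Proof. exact: (@opp_row_mx F n 1 m). Qed.

Lemma mul_scalar_row_mxS A c (v : 'rV[F]_m) :
  A *m (row_mx c%:M v : 'rV[F]_m.+1) = blk (c *: A) (A *m v).
Proof. by rewrite -mul_mx_scalar; apply: (@mul_mx_row F n 1 1 m). Qed.

End RowMxS.

Section Lift.
Variable F : finFieldType.
Implicit Types (S : {set 'cV[F]_2}) (s : 'cV[F]_2).

Lemma lift_pivot S m s (y : 'rV[F]_m) : s \in S -> s != 0 ->
  (row_mx s (s *m y) : 'M[F]_(2, 1 + m)) \in lift_set S m.+1.
Proof.
move=> Ss s0; apply/finset.setUP; left; apply/imsetP; exists (s, y) => //.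
by apply/setXP; rewrite !inE s0.
Qed.

Lemma lift_skip S m (Z : 'M[F]_(2, m)) : Z \in lift_set S m ->
  (row_mx 0 Z : 'M[F]_(2, 1 + m)) \in lift_set S m.+1.
Proof. by move=> SZ; apply/finset.setUP; right; apply: imset_f. Qed.

Lemma lift0 S m : 0 \in lift_set S m.
Proof.
elim: m => [|m IHm]; first by rewrite inE.
by have := lift_skip IHm; rewrite row_mx0.
Qed.

(** Only additive structure is asked, so that both two-dimensional [K]-subspaces and [F]-lines of
    [F^2] qualify. *)
Definition additive_section S : Prop :=
  [/\ 0 \in S, {in S &, forall x y, x - y \in S} & #|S| = #|F|].

(** With [q = #|F|], the induction step is [(q - 1) q^m + q^m = q^(m + 1)]. *)
Lemma card_lift S m : additive_section S -> (#|lift_set S m| <= #|F| ^ m)%N.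
Proof.
case=> S0 _ cardS; elim: m => [|m IHm]; first by rewrite /= cards1.
apply: leq_trans (leq_card_setU _ _) _.
have cardS0 : #|S :\ 0| = #|F|.-1 by rewrite -cardS (cardsD1 0 S) S0.
have F_gt0 : (0 < #|F|)%N by rewrite -cardS card_gt0; apply/set0Pn; exists 0.
apply: leq_trans (leq_add (leq_imset_card _ _) (leq_imset_card _ _)) _.
rewrite cardsX cardsT card_mx mul1n cardS0 expnS -[in leqRHS](prednK F_gt0) mulSn.
by rewrite (prednK F_gt0) addnC leq_add2r.
Qed.

Lemma scaled_section_cover S1 S2 (a b : F) :
  a != 0 -> b != 0 -> additive_section S1 -> additive_section S2 ->
  {in S1 & S2, forall s t, s != 0 -> t != 0 -> indep s t} ->
  forall z, exists s t, [/\ s \in S1, t \in S2 & z = a *: s + b *: t].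
Proof.
move=> a0 b0 [_ S1B card1] [_ S2B card2] S12 z.
have [||||_ [_ [/imsetP[s Ss ->] /imsetP[t St ->] ->]]] := @direct_cover _
    [set a *: s | s in S1] [set b *: t | t in S2] _ _ _ _ z.
- move=> _ _ /imsetP[s Ss ->] /imsetP[t St ->].
  by rewrite -scalerBr imset_f // S1B.
- move=> _ _ /imsetP[s Ss ->] /imsetP[t St ->].
  by rewrite -scalerBr imset_f // S2B.
- move=> _ /imsetP[s Ss ->] /imsetP[t St eqst].
  have [->|s0] := eqVneq s 0; first by rewrite scaler0.
  have [t0|t0] := eqVneq t 0; first by rewrite eqst t0 scaler0.
  have [|/eqP] := S12 s t Ss St s0 t0 a (- b); first by rewrite eqst scaleNr subrr.
  by rewrite (negPf a0).
- rewrite !card_imset; [|exact: scalerI..].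
  by rewrite card1 card2 card_mx muln1 mulnn.
by exists s, t.
Qed.

(** The case of [scaled_section_cover] where the first section is the [F]-line of [s]. *)
Lemma line_section_cover S s (b : F) :
  b != 0 -> additive_section S -> s != 0 ->
  {in S, forall t, t != 0 -> indep s t} ->
  forall z, exists al t, t \in S /\ z = al *: s + b *: t.
Proof.
move=> b0 Sadd s0 Ss z.
have [||_ [t [/imsetP[al _ ->] St ->]]] := scaled_section_cover
    (S1 := [set al *: s | al in [set: F]]) (oner_neq0 F) b0 _ Sadd _ z.
- split=> [|_ _ /imsetP[x _ ->] /imsetP[y _ ->]|].
  + by apply/imsetP; exists 0; rewrite ?inE ?scale0r.
  + by rewrite -scalerBl; apply: (imset_f (fun al => al *: s)); rewrite inE.
  rewrite card_imset ?cardsT // => x y /eqP.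
  by rewrite -subr_eq0 -scalerBl scaler_eq0 (negPf s0) orbF subr_eq0 => /eqP.
- move=> _ t /imsetP[x _ ->] St xs0 t0; rewrite -[t]scale1r.
  apply: indepZ (oner_neq0 F) (Ss t St t0).
  by apply: contraNneq xs0 => ->; rewrite scale0r.
by exists al, t; rewrite scale1r.
Qed.

(** Covers the columns after one in which a single summand has found its pivot [s], with [y] then
    free. Once the other summand has a pivot [t], the vectors [s] and [t] form a basis of [F^2] and
    the remaining columns are solved at once. *)
Lemma lift_line_cover S s (b : F) m (Z : 'M[F]_(2, m)) :
  b != 0 -> additive_section S -> s != 0 ->
  {in S, forall t, t != 0 -> indep s t} ->
  exists (y : 'rV[F]_m) T, T \in lift_set S m /\ Z = s *m y + b *: T.
Proof.
move=> b0 Sadd s0 Ss; elim: m Z => [|m IHm] Z.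
  by exists 0, 0; rewrite lift0 [Z]thinmx0 [RHS]thinmx0.
pose Z0 := lsubmx (Z : 'M[F]_(2, 1 + m)); pose Z1 := rsubmx (Z : 'M[F]_(2, 1 + m)).
have ZE : Z = row_mx Z0 Z1 by rewrite hsubmxK.
have [al [t [St Z0E]]] := line_section_cover b0 Sadd s0 Ss Z0.
have [t0|t0] := eqVneq t 0.
  have [y [T [ST Z1E]]] := IHm Z1.
  exists (row_mx al%:M y : 'rV[F]_(1 + m)), (row_mx 0 T : 'M[F]_(2, 1 + m)).
  split; first exact: lift_skip.
  rewrite ZE mul_scalar_row_mxS scale_row_mxS scaler0 add_row_mxS addr0 -Z1E.
  by rewrite Z0E t0 scaler0 addr0.
have [u [v Z1E]] := indep_solve Z1 (indepZ (oner_neq0 F) b0 (Ss t St t0)).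
exists (row_mx al%:M u : 'rV[F]_(1 + m)), (row_mx t (t *m v) : 'M[F]_(2, 1 + m)).
split; first exact: lift_pivot.
rewrite ZE mul_scalar_row_mxS scale_row_mxS add_row_mxS -Z0E Z1E scale1r.
by rewrite scalemxAl.
Qed.

(** The first column is [a *: s + b *: t]. Zero [s] and [t] leave the induction hypothesis, one
    nonzero vector leads to [lift_line_cover], and two nonzero vectors form a basis. *)
Lemma lift_sum_cover S1 S2 (a b : F) m (Z : 'M[F]_(2, m)) :
  a != 0 -> b != 0 -> additive_section S1 -> additive_section S2 ->
  {in S1 & S2, forall s t, s != 0 -> t != 0 -> indep s t} ->
  exists T1 T2, [/\ T1 \in lift_set S1 m, T2 \in lift_set S2 m
                  & Z = a *: T1 + b *: T2].
Proof.
move=> a0 b0 S1add S2add S12; elim: m Z => [|m IHm] Z.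
  by exists 0, 0; rewrite !lift0 [Z]thinmx0 [RHS]thinmx0.
pose Z0 := lsubmx (Z : 'M[F]_(2, 1 + m)); pose Z1 := rsubmx (Z : 'M[F]_(2, 1 + m)).
have ZE : Z = row_mx Z0 Z1 by rewrite hsubmxK.
have [s [t [Ss St Z0E]]] := scaled_section_cover a0 b0 S1add S2add S12 Z0.
have [s0|s0] := eqVneq s 0; have [t0|t0] := eqVneq t 0.
- have [T1 [T2 [ST1 ST2 Z1E]]] := IHm Z1.
  exists (row_mx 0 T1 : 'M[F]_(2, 1 + m)), (row_mx 0 T2 : 'M[F]_(2, 1 + m)).
  split; [exact: lift_skip..|].
  by rewrite ZE !scale_row_mxS !scaler0 add_row_mxS -Z1E Z0E s0 t0 !scaler0 addr0.
- have [|y [T [ST Z1E]]] := lift_line_cover Z1 a0 S1add t0.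
    by move=> s' Ss' s'0; apply: indep_sym; apply: S12.
  (* The factor [b^-1] cancels the scalar [b] in front of the second summand. *)
  exists (row_mx 0 T : 'M[F]_(2, 1 + m)), (row_mx t (t *m (b^-1 *: y)) : 'M[F]_(2, 1 + m)).
  split; [exact: lift_skip|exact: lift_pivot|].
  rewrite ZE !scale_row_mxS add_row_mxS scaler0 add0r -scalemxAr scalerA divff //.
  by rewrite scale1r addrC -Z1E Z0E s0 scaler0 add0r.
- have [|y [T [ST Z1E]]] := lift_line_cover Z1 b0 S2add s0.
    by move=> t' St' t'0; apply: S12.
  exists (row_mx s (s *m (a^-1 *: y)) : 'M[F]_(2, 1 + m)), (row_mx 0 T : 'M[F]_(2, 1 + m)).
  split; [exact: lift_pivot|exact: lift_skip|].
  rewrite ZE !scale_row_mxS add_row_mxS scaler0 addr0 -scalemxAr scalerA divff //.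
  by rewrite scale1r -Z1E Z0E t0 scaler0 addr0.
have [u [v Z1E]] := indep_solve Z1 (indepZ a0 b0 (S12 s t Ss St s0 t0)).
exists (row_mx s (s *m u) : 'M[F]_(2, 1 + m)), (row_mx t (t *m v) : 'M[F]_(2, 1 + m)).
split; [exact: lift_pivot..|].
by rewrite ZE !scale_row_mxS add_row_mxS -Z0E Z1E -!scalemxAl.
Qed.

(** The first nonzero column [l *: s] selects the section [S]. Writing [s] as [(s - t) - (- t)] with
    [t] in [S] independent of [s] gives two independent pivots, and the later columns can be
    solved. *)
Lemma lift_diff_cover (P : {set 'cV[F]_2} -> Prop) m (Z : 'M[F]_(2, m)) :
  (forall S, P S -> additive_section S) ->
  (forall S s, P S -> s \in S -> s != 0 -> exists2 t, t \in S & indep s t) ->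
  (exists S, P S) ->
  (forall z, z != 0 -> exists S l s, [/\ P S, s \in S & z = l *: s]) ->
  exists S l T1 T2, [/\ P S, T1 \in lift_set S m, T2 \in lift_set S m
                       & Z = l *: (T1 - T2)].
Proof.
move=> Padd Pindep [S1 PS1] Pcover; elim: m Z => [|m IHm] Z.
  by exists S1, 0, 0, 0; rewrite !lift0 [Z]thinmx0 [RHS]thinmx0.
pose Z0 := lsubmx (Z : 'M[F]_(2, 1 + m)); pose Z1 := rsubmx (Z : 'M[F]_(2, 1 + m)).
have ZE : Z = row_mx Z0 Z1 by rewrite hsubmxK.
have [z0|z0] := eqVneq Z0 0.
  have [S [l [T1 [T2 [PS ST1 ST2 Z1E]]]]] := IHm Z1.
  exists S, l, (row_mx 0 T1 : 'M[F]_(2, 1 + m)), (row_mx 0 T2 : 'M[F]_(2, 1 + m)).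
  split=> //; [exact: lift_skip..|].
  by rewrite ZE opp_row_mxS add_row_mxS scale_row_mxS -Z1E z0 subr0 scaler0.
have [S [l [s [PS Ss Z0E]]]] := Pcover Z0 z0.
have s0 : s != 0 by apply: contraNneq z0 => s0; rewrite Z0E s0 scaler0.
have l0 : l != 0 by apply: contraNneq z0 => l0; rewrite Z0E l0 scale0r.
have [t St st] := Pindep S s PS Ss s0.
have [S0 SB _] := Padd S PS.
have t0 := indep_neq0 (indep_sym st).
have Sst : s - t \in S by apply: SB.
have stt : indep (s - t) t.
  move=> al be; rewrite scalerBr -addrA -scaleNr -scalerDl => /st[-> /eqP].
  by rewrite oppr0 add0r => /eqP ->.
have [u [v Z1E]] := indep_solve (l^-1 *: Z1) stt.
have mt0 : - t != 0 by rewrite oppr_eq0.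
have Smt : - t \in S by rewrite -sub0r SB.
exists S, l, (row_mx (s - t) ((s - t) *m u) : 'M[F]_(2, 1 + m)).
exists (row_mx (- t) (- t *m v) : 'M[F]_(2, 1 + m)); split=> //.
- exact: lift_pivot (indep_neq0 stt).
- exact: lift_pivot.
rewrite ZE opp_row_mxS add_row_mxS scale_row_mxS opprK subrK -Z0E.
by rewrite mulNmx opprK -Z1E scalerA divff // scale1r.
Qed.

End Lift.

(** * The sections [g K^2] *)

Section SubplaneSection.
Variables (F : finFieldType) (K : {set F}).
Hypotheses (K_sub : subfield_set K) (cardF : #|F| = (#|K| ^ 2)%N).

Definition subplane (g : 'M[F]_2) : {set 'cV[F]_2} :=
  [set g *m b | b in [set v : 'cV[F]_2 | v \is a mxOver K]].

Lemma mem_subplane g (b : 'cV[F]_2) :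
  b \is a mxOver K -> g *m b \in subplane g.
Proof. by move=> bK; apply: imset_f; rewrite inE. Qed.

Lemma subplaneP g s :
  reflect (exists2 b : 'cV[F]_2, b \is a mxOver K & s = g *m b)
          (s \in subplane g).
Proof.
by apply: (iffP imsetP) => -[b]; rewrite ?inE => bK ->; exists b; rewrite ?inE.
Qed.

Lemma subplane_additive g : g \in unitmx -> additive_section (subplane g).
Proof.
move=> gU; split.
- by rewrite -(mulmx0 _ g) mem_subplane //; apply/mxOverP => i j; rewrite mxE subfield0.
- move=> _ _ /subplaneP[a aK ->] /subplaneP[b bK ->].
  by rewrite -mulmxBr mem_subplane // subfield_mxB.
by rewrite card_imset ?card_colOver //; apply: can_inj (mulKmx gU).
Qed.

(** One of the two unit vectors is independent of the preimage of [s]. This is the second pivot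
    needed in [lift_diff_cover]. *)
Lemma subplane_not_line g s : g \in unitmx -> s \in subplane g -> s != 0 ->
  exists2 t, t \in subplane g & indep s t.
Proof.
move=> gU /subplaneP[b bK ->]; rewrite unit_mulmx_eq0 // => b0.
have overK (x y : F) : x \in K -> y \in K -> \col_(i < 2) [:: x; y]`_i \is a mxOver K.
  by move=> xK yK; apply/mxOverP => -[[|[|//]] ?] j; rewrite mxE.
have [K0 K1] := (subfield0 K_sub, subfield1 K_sub).
have gindep v : indep b v -> indep (g *m b) (g *m v).
  by move=> bv; apply: (@indep_mulmx _ _ (invmx g)); rewrite !mulKmx.
have [b00|b00] := eqVneq (b 0 0) 0.
  exists (g *m \col_i [:: 1; 0]`_i); first exact/mem_subplane/overK.
  apply: gindep => al be /colP dep.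
  have al0 : al = 0.
    have := dep 1; rewrite !mxE /= mulr0 addr0 => /eqP.
    rewrite mulf_eq0 => /orP[/eqP //|/eqP b10].
    by case/eqP: b0; apply: colP2; rewrite !mxE.
  by split=> //; have := dep 0; rewrite !mxE al0 mul0r add0r /= mulr1.
exists (g *m \col_i [:: 0; 1]`_i); first exact/mem_subplane/overK.
apply: gindep => al be /colP dep.
have al0 : al = 0.
  have := dep 0; rewrite !mxE /= mulr0 addr0 => /eqP.
  by rewrite mulf_eq0 (negPf b00) orbF => /eqP.
by split=> //; have := dep 1; rewrite !mxE al0 mul0r add0r /= mulr1.
Qed.

End SubplaneSection.

(** * Assembly of the saturating set in [F^(3 + 2m)] *)

Definition two_saturating (F : finFieldType) n (X : {set 'cV[F]_n}) : Prop :=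
  forall s, exists x y a b, [/\ x \in X, y \in X & s = a *: x + b *: y].

Lemma leq_card_bigcup (I : finType) (T : finType) (A : I -> {set T}) (N : nat) :
  (forall i, #|A i| <= N)%N -> (#|(\bigcup_i A i)%SET| <= #|I| * N)%N.
Proof.
move=> leAN; rewrite -sum_nat_const.
elim/big_ind2: _ => [|A1 n1 A2 n2 le1 le2|i _]; rewrite ?cards0 //.
exact: leq_trans (leq_card_setU _ _) (leq_add le1 le2).
Qed.

Lemma saturating_columns (F : finFieldType) (k K : {set F}) m :
  subfield_set k -> subfield_set K -> {subset k <= K} -> (1 < #|k|)%N ->
  #|K| = (#|k| ^ 2)%N -> #|F| = (#|K| ^ 2)%N ->
  exists2 X : {set 'cV[F]_(3 + 2 * m)},
    (#|X| <= 2 * (#|k| ^ 2 + #|k| + 1) * #|F| ^ m)%N & two_saturating X.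
Proof.
move=> k_sub K_sub kK k_gt1 cardK cardF.
have K_gt2 : (2 < #|K|)%N.
  by rewrite cardK (@leq_trans (2 ^ 2)) // leq_exp2r.
have K_gt1 := ltnW K_gt2.
have ltFK : (#|F| < #|K| ^ 3)%N by rewrite cardF ltn_exp2l.
have ltKk : (#|K| < #|k| ^ 3)%N by rewrite cardK ltn_exp2l.
have [th thK thNk] : exists2 th, th \in K & th \notin k.
  apply/subsetPn; apply: contraL k_gt1 => /subset_leq_card.
  by rewrite cardK -leqNgt -[leqRHS]expn1; case: #|k| => [|[|n]] //; rewrite leq_exp2l.
(* Here the exponent is [1.+2], which matches [companion3]. *)
have [c ck no_root] := subfield_artin_gap k_sub 1.
pose G2 : 'M[F]_3 := 1%:M + th *: companion3 c.
have one_over n : (1%:M : 'M[F]_n) \is a mxOver K.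
  apply/mxOverP => i j; rewrite mxE.
  by case: eqP => _; [apply: subfield1|apply: subfield0].
have G2_over : G2 \is a mxOver K.
  rewrite -[G2]opprK -sub0r; apply: (subfield_mxB K_sub).
    by apply/mxOverP => i j; rewrite mxE subfield0.
  rewrite opprD; apply: (subfield_mxB K_sub).
    by apply/mxOverP => i j; rewrite mxE (subfieldN K_sub) // (mxOverP (one_over 3)).
  apply: (subfield_scalemx K_sub) => //; apply: (mxOver_sub kK).
  exact: companion3_over.
have dis a b : a \is a mxOver k -> b \is a mxOver k -> a != 0 -> b != 0 ->
    indep (1%:M *m a) (G2 *m b).
  move=> ak bk a0 b0; rewrite mul1mx.
  apply: (twisted_indep k_sub K_sub kK cardK) => //; first exact: companion3_over.
  by move=> v x _; apply: companion3_no_eigen.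
have [GA [GB [/andP[GA_gt0 GA_le] /andP[GB_gt0 GB_le] G_unit G_indep G_cover]]] :=
  plane_family K_sub K_gt2 cardF.
pose N0 := (#|k| ^ 2 + #|k| + 1)%N.
have GA_leN : (size GA <= N0)%N.
  by apply: leq_trans GA_le _; rewrite cardK /N0 addn1 ltnS leq_addr.
have GB_leN : (size GB <= N0)%N.
  by apply: leq_trans GB_le _; rewrite cardK /N0 -addnA leq_addr.
pose P (i : 'I_N0) := nth 0 (plane_points k) i.
(* A subplane has at least as many points as [GA] or [GB] has members: each member is attached to
   some point, and indices past the end reuse the head. *)
pose A (i : 'I_N0) := nth (head 0 GA) GA i.
pose B (i : 'I_N0) := nth (head 0 GB) GB i.
have head_mem (G : seq 'M[F]_2) i : (0 < size G)%N -> nth (head 0 G) G i \in G.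
  case: G => //= g G _; case: (ltnP i (size (g :: G))) => [|le_i].
    exact: mem_nth.
  by rewrite nth_default ?mem_head.
have AG i : A i \in GA ++ GB by rewrite mem_cat head_mem.
have BG i : B i \in GA ++ GB by rewrite mem_cat head_mem ?orbT.
have nth_onto (T : eqType) (x0 x : T) s : x \in s -> (size s <= N0)%N ->
    exists i : 'I_N0, nth x0 s i = x.
  move=> xs le_s; have lt_i : (index x s < N0)%N by rewrite (leq_trans _ le_s) ?index_mem.
  by exists (Ordinal lt_i); rewrite nth_index.
pose emb (h : 'cV[F]_3) (Z : 'M[F]_(2, m)) : 'cV[F]_(3 + 2 * m) :=
  col_mx h (mxvec Z)^T.
have embD a b h h' Z Z' :
    emb (a *: h + b *: h') (a *: Z + b *: Z') = a *: emb h Z + b *: emb h' Z'.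
  by rewrite /emb !scale_col_mx add_col_mx !linearP !linearZ.
pose XA i := [set emb (P i) T | T in lift_set (subplane K (A i)) m].
pose XB i := [set emb (G2 *m P i) T | T in lift_set (subplane K (B i)) m].
pose X := (\bigcup_i (XA i :|: XB i))%SET.
have memXA i T : T \in lift_set (subplane K (A i)) m -> emb (P i) T \in X.
  by move=> iT; apply/finset.bigcupP; exists i => //; rewrite inE imset_f.
have memXB i T : T \in lift_set (subplane K (B i)) m -> emb (G2 *m P i) T \in X.
  move=> iT; apply/finset.bigcupP; exists i => //.
  by rewrite inE (imset_f (emb (G2 *m P i))) ?orbT.
exists X.
  rewrite -mulnA mulnCA -/N0 -[X in (_ <= X * _)%N](card_ord N0).
  apply: leq_card_bigcup => i; apply: leq_trans (leq_card_setU _ _) _.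
  rewrite [leqRHS]mul2n -addnn leq_add //; apply: leq_trans (leq_imset_card _ _) _;
    by apply: card_lift; apply: subplane_additive => //; apply: G_unit.
move=> s; pose h := usubmx s; pose Z := vec_mx (dsubmx s)^T.
have -> : s = emb h Z by rewrite /emb vec_mxK trmxK vsubmxK.
have [h0|h0] := eqVneq h 0; last first.
  have [a [b [l [l' [[ak bk a0 b0] [l0 l'0 hE]]]]]] :=
    two_subplanes_saturate k_sub K_sub kK K_gt1 ltFK ltKk (one_over 3) G2_over dis h0.
  have [x [p [x0 pP aE]]] := plane_points_normalise k_sub ak a0.
  have [y [p' [y0 p'P bE]]] := plane_points_normalise k_sub bk b0.
  have size_pts : (size (plane_points k) <= N0)%N by rewrite size_plane_points.
  have [i iE] := nth_onto _ 0 _ _ pP size_pts.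
  have [j jE] := nth_onto _ 0 _ _ p'P size_pts.
  have [|||||T1 [T2 [ST1 ST2 ZE]]] := @lift_sum_cover F
      (subplane K (A i)) (subplane K (B j)) (l * x) (l' * y) m Z.
  - by rewrite mulf_neq0.
  - by rewrite mulf_neq0.
  - by apply: subplane_additive => //; apply: G_unit.
  - by apply: subplane_additive => //; apply: G_unit.
  - move=> _ _ /subplaneP[v vK ->] /subplaneP[w wK ->] v0 w0.
    apply: G_indep => //; first [exact: head_mem | idtac].
    + by apply: contraNneq v0 => ->; rewrite mulmx0.
    + by apply: contraNneq w0 => ->; rewrite mulmx0.
  exists (emb (P i) T1), (emb (G2 *m P j) T2), (l * x), (l' * y).
  rewrite memXA // memXB //; split=> //; rewrite -embD -ZE; congr emb.
  by rewrite hE aE bE mul1mx -scalemxAr !scalerA /P iE jE.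
(* For [h = 0] the two columns are taken over the same point, with opposite coefficients that cancel
   its [F^3] part. *)
have [||||S [l [T1 [T2 [[i SE] ST1 ST2 ZE]]]]] := @lift_diff_cover F
    (fun S => exists i, S = subplane K (A i) \/ S = subplane K (B i)) m Z.
- by move=> S [i [] ->]; apply: subplane_additive => //; apply: G_unit.
- by move=> S t [i [] ->]; apply: subplane_not_line => //; apply: G_unit.
- by have [i _] := nth_onto _ (head 0 GA) _ _ (head_mem GA 0 GA_gt0) GA_leN;
    exists (subplane K (A i)), i; left.
- move=> z /G_cover[g [b [l [+ bK ->]]]]; rewrite mem_cat => /orP[] gG.
    have [i iE] := nth_onto _ (head 0 GA) _ _ gG GA_leN.
    exists (subplane K (A i)), l, (g *m b); split=> //; first by exists i; left.
    by rewrite /A iE mem_subplane.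
  have [i iE] := nth_onto _ (head 0 GB) _ _ gG GB_leN.
  exists (subplane K (B i)), l, (g *m b); split=> //; first by exists i; right.
  by rewrite /B iE mem_subplane.
have diffE (p : 'cV[F]_3) : emb h Z = l *: emb p T1 + - l *: emb p T2.
  by rewrite -embD h0 ZE -scalerDl subrr scale0r scalerBr scaleNr.
case: SE => SE; rewrite SE in ST1 ST2.
  by exists (emb (P i) T1), (emb (P i) T2), l, (- l); rewrite !memXA.
by exists (emb (G2 *m P i) T1), (emb (G2 *m P i) T2), l, (- l); rewrite !memXB.
Qed.

(** * From saturating sets to codes of covering radius exactly two *)

Lemma covering_code_of_saturating (F : finFieldType) r n (X : {set 'cV[F]_r}) :
  (0 < n)%N -> (#|X| <= n)%N -> (n * #|F| < #|F| ^ r)%N -> two_saturating X ->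
  exists C : {vspace 'rV[F]_n}, covering_code r 2 C.
Proof.
move=> n_gt0 leXn lt_nq satX.
(* The default [0] of [nth] supplies the zero columns that pad the length to [n]. *)
pose H : 'M[F]_(r, n) := \matrix_(i, j) (nth 0 (enum X) j) i 0.
have colH j : col j H = nth 0 (enum X) j by apply/colP => i; rewrite !mxE.
have XH x : x \in X -> exists j, col j H = x.
  move=> Xx; have lt_x : (index x (enum X) < n)%N.
    by apply: leq_trans leXn; rewrite cardE index_mem mem_enum.
  by exists (Ordinal lt_x); rewrite colH nth_index // mem_enum.
(* A row vector that kills all columns kills every unit vector, since the columns span. *)
have H_free : row_free H.
  apply: inj_row_free => v vH; apply: trmx_inj; rewrite trmx0; apply/colP => i.
  have [x [y [a [b [/XH[jx <-] /XH[jy <-] eE]]]]] := satX (delta_mx i 0).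
  have vcol j : v *m col j H = 0 by rewrite colE mulmxA vH mul0mx.
  have : v *m (delta_mx i 0 : 'cV[F]_r) = 0.
    by rewrite eE mulmxDr -!scalemxAr !vcol !scaler0 addr0.
  by rewrite -colE => /colP/(_ 0); rewrite !mxE.
pose f : 'Hom('rV[F]_n, 'rV[F]_r) := linfun (mulmxr H^T).
have fE v : f v = v *m H^T by rewrite lfunE.
exists (lker f); split.
  have dim_img : \dim (limg f) = r.
    have -> : limg f = fullv.
      have /row_freeP[D HD] := H_free.
      apply/vspaceP => v; rewrite memvf; apply/memv_imgP; exists (v *m D^T).
        exact: memvf.
      by rewrite fE -mulmxA -trmx_mul HD trmx1 mulmx1.
    by rewrite dimvf /dim /= mul1n.
  by have := limg_ker_dim f fullv; rewrite capfv dim_img dimvf /dim /= mul1n.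
exists H; split.
- split=> // c; rewrite memv_ker fE; split=> [/eqP cH|cH].
    by apply: trmx_inj; rewrite trmx_mul trmxK trmx0.
  by apply/eqP/trmx_inj; rewrite trmx_mul trmxK trmx0.
- move=> s; have [x [y [a [b [/XH[jx <-] /XH[jy <-] ->]]]]] := satX s.
  (* When both vectors come from one column, the coefficients are added on a singleton. *)
  have [<-|neq_j] := eqVneq jx jy.
    by exists [set jx], (fun=> a + b); rewrite cards1 finset.big_set1 scalerDl.
  exists [set jx; jy], (fun j => if j == jx then a else b).
  by rewrite cards2 neq_j big_setU1 ?inE //= finset.big_set1 eqxx eq_sym (negPf neq_j).
move=> rho' cover; rewrite ltnNge; apply/negP => rho'_le1.
(* With at most one column, at most [n * #|F|] vectors are reached, fewer than [#|F| ^ r]. *)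
pose g (p : 'I_n * F) := p.2 *: col p.1 H.
have : [set: 'cV[F]_r] \subset g @: [set: 'I_n * F].
  apply/fintype.subsetP => s _; have [J [a [leJ ->]]] := cover s.
  have [J0|[j Jj]] := set_0Vmem J.
    rewrite J0 finset.big_set0; apply/imsetP; exists (Ordinal n_gt0, 0) => //.
    by rewrite /g scale0r.
  have -> : J = [set j].
    apply/esym/eqP; rewrite eqEcard finset.sub1set Jj cards1.
    exact: leq_trans leJ rho'_le1.
  by rewrite finset.big_set1; apply/imsetP; exists (j, a j).
move=> /subset_leq_card; rewrite leqNgt; apply/negP; rewrite negbK.
apply: leq_ltn_trans (leq_imset_card _ _) _.
by rewrite !cardsT card_prod card_ord card_mx muln1.
Qed.

Lemma codes_exist (F : finFieldType) (q' m n : nat) :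
  prime_power q' -> #|F| = (q' ^ 4)%N ->
  (2 * (q' ^ 2 + q' + 1) * #|F| ^ m <= n)%N ->
  (n <= (2 * (q' ^ 2 + q' + 1) + 1) * #|F| ^ m)%N ->
  exists C : {vspace 'rV[F]_n}, covering_code (3 + 2 * m) 2 C.
Proof.
move=> [p [e [p_pr e_gt0 q'E]]] cardF le_n n_le.
have q'_gt1 : (1 < q')%N.
  by rewrite q'E -(expn0 p) ltn_exp2l ?prime_gt1.
have charp : p \in [pchar F].
  by apply: (@card_finPcharP F p (e * 4)) => //; rewrite cardF q'E expnM.
pose k := [set x : F | x ^+ q' == x]; pose K := [set x : F | x ^+ (q' ^ 2) == x].
have cardk : #|k| = q' by apply: card_fixed_pow cardF.
have cardK : #|K| = (q' ^ 2)%N.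
  apply: (@card_fixed_pow F _ 2) => //; last by rewrite cardF -expnM.
  by rewrite -(expn0 q') ltn_exp2l.
have k_sub : subfield_set k by rewrite /k q'E; apply: subfield_fixed_pow.
have K_sub : subfield_set K by rewrite /K q'E -expnM; apply: subfield_fixed_pow.
have kK : {subset k <= K}.
  by move=> x; rewrite !inE expnS expn1 exprM => /eqP xk; rewrite !xk.
have [|||X leX satX] := @saturating_columns F k K m k_sub K_sub kK.
- by rewrite cardk.
- by rewrite cardK cardk.
- by rewrite cardK cardF -expnM.
have q_gt0 : (0 < #|F|)%N by rewrite cardF expn_gt0 ltnW.
apply: (covering_code_of_saturating (X := X)) => //.
- by apply: leq_trans le_n; rewrite !muln_gt0 expn_gt0 q_gt0 addn1.
- by apply: leq_trans le_n; rewrite -cardk.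
(* With [q = #|F|], the factor [2 (q'^2 + q' + 1) + 1] is below [q^2 = q'^8], so
   [n q < q^(m + 3) <= q^(3 + 2m)]. *)
apply: leq_ltn_trans (leq_mul n_le (leqnn _)) _.
rewrite -mulnA -expnSr (@leq_trans (#|F| ^ 2 * #|F| ^ m.+1)) //.
  rewrite ltn_pmul2r ?expn_gt0 ?q_gt0 // cardF.
  rewrite -expnM -[(4 * 2)%N]/(2 + 6)%N expnD.
  have : (2 ^ 6 <= q' ^ 6)%N by rewrite leq_exp2r.
  nia.
rewrite -expnD leq_exp2l; first lia.
by rewrite cardF -(expn0 q') ltn_exp2l.
Qed.

(** * Length formula and covering density *)

(** For [r = 3 + 2m] the second summand is the floor of [q^(m - 1)], which is [0] at [m = 0]. *)
Definition code_length (q' r : nat) : nat :=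
  let m := (r - 3)./2 in
  (2 * (q' ^ 2 + q' + 1) * (q' ^ 4) ^ m
    + (if m is m'.+1 then (q' ^ 4) ^ m' else 0))%N.

Section Numerics.
Variables (R : realType) (x : R).
Hypothesis x_ge2 : 2 <= x.

Let x_gt0 : 0 < x. Proof. exact: lt_le_trans x_ge2. Qed.

Lemma powR_fourth (y : R) : (x ^+ 4) `^ y = x `^ (4 * y).
Proof. by rewrite powRrM -[4]/(4%:R) powR_mulrn // ltW. Qed.

Lemma powR_fourth_nat (y : R) (n : nat) : 4 * y = n%:R -> (x ^+ 4) `^ y = x ^+ n.
Proof. by move=> yn; rewrite powR_fourth yn powR_mulrn // ltW. Qed.

(** After multiplication by [2 x^20] the difference is a polynomial: [20 x^14] absorbs the terms of
    degree at most 6, [12 x^13] those of degree 11 and 10, and [3 x^8] is positive. *)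
Lemma density_limit_bound :
  (x ^+ 4 - 1) ^+ 2 * (2 * (x ^+ 2 + x + 1) * x ^+ 4 + 1) ^+ 2
    / (2 * (x ^+ 4) ^+ 5)
  < 2 + 4 / x + 6 / x ^+ 2 + 4 / x ^+ 3 - 2 / x ^+ 4 - 8 / (x ^+ 4 * x).
Proof.
have x_neq0 : x != 0 by rewrite gt_eqF.
rewrite ltr_pdivrMr ?mulr_gt0 ?exprn_gt0 // -subr_gt0.
rewrite (_ : _ - _ = 20 * x ^+ 14 + 12 * x ^+ 13 - 8 * x ^+ 11 - 4 * x ^+ 10
  + 3 * x ^+ 8 - 4 * x ^+ 6 - 4 * x ^+ 5 - 2 * x ^+ 4 - 1); last by field.
have x_ge1 : 1 <= x by apply: le_trans x_ge2; rewrite ler1n.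
have mono i j : (i <= j)%N -> x ^+ i <= x ^+ j by move=> ?; apply: ler_weXn2l.
move: (mono 11 13 isT) (mono 10 13 isT) (mono 6 14 isT) (mono 5 14 isT).
move: (mono 4 14 isT) (exprn_ege1 14 x_ge1) (exprn_gt0 8 x_gt0).
move: (x ^+ 14) (x ^+ 13) (x ^+ 11) (x ^+ 10) (x ^+ 8) (x ^+ 6) (x ^+ 5) (x ^+ 4).
move=> {mono} *; lra.
Qed.

End Numerics.

Lemma code_lengthE (R : realType) (q' m : nat) :
  (1 < q')%N ->
  (code_length q' (3 + 2 * m))%:R =
    (2 + 2 / (q' ^ 4)%:R `^ (1 / 4) + 2 / Num.sqrt (q' ^ 4)%:R)
      * (q' ^ 4)%:R `^ (((3 + 2 * m)%:R - 2) / 2)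
    + (Num.floor ((q' ^ 4)%:R `^ (((3 + 2 * m)%:R - 5) / 2) : R))%:~R :> R.
Proof.
move=> q'_gt1; have -> : (q' ^ 4)%:R = q'%:R ^+ 4 :> R by rewrite natrX.
set x : R := q'%:R.
have x_ge2 : 2 <= x by rewrite ler_nat.
have x_gt0 : 0 < x by apply: lt_le_trans x_ge2.
have x_neq0 : x != 0 by rewrite gt_eqF.
have x4_gt0 : 0 < x ^+ 4 by rewrite exprn_gt0.
have -> : (x ^+ 4) `^ (1 / 4) = x.
  by rewrite (@powR_fourth_nat _ _ x_ge2 _ 1) //; field.
have -> : Num.sqrt (x ^+ 4) = x ^+ 2.
  by rewrite (exprM x 2 2) sqrtr_sqr ger0_norm // exprn_ge0 // ltW.
have -> : (3 + 2 * m)%:R = 3 + 2 * m%:R :> R by rewrite natrD natrM.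
(* The exponent is [m + 1/2], and the square root of [x ^+ 4] is [x ^+ 2]. *)
have -> : (x ^+ 4) `^ ((3 + 2 * m%:R - 2) / 2) = x ^+ 2 * (x ^+ 4) ^+ m.
  rewrite -exprM -exprD; apply: (powR_fourth_nat x_ge2).
  by rewrite natrD natrM; field.
have -> : Num.floor ((x ^+ 4) `^ ((3 + 2 * m%:R - 5) / 2))
    = (if m is m'.+1 then (q' ^ 4) ^ m' else 0)%N%:Z.
  case: m => [|m].
    rewrite (_ : _ / 2 = -1); last by field.
    rewrite powR_inv1 ?ltW //; apply: floor_def.
    rewrite add0r invr_ge0 ltW //= invf_lt1 // exprn_egt1 //.
    by apply: lt_le_trans x_ge2; rewrite ltr1n.
  rewrite (_ : _ / 2 = m%:R); last by rewrite -natr1; field.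
  have -> : (x ^+ 4) `^ m%:R = ((q' ^ 4) ^ m)%:R.
    by rewrite powR_mulrn ?ltW // !natrX.
  apply: floor_def; apply/andP; split; first exact: lexx.
  by rewrite intrD [X in X < _](_ : _ = ((q' ^ 4) ^ m)%N%:~R) // ltrDl ltr01.
rewrite /code_length (_ : (_ - 3)./2 = m); last lia.
rewrite natrD; congr (_ + _).
have -> : (2 * (q' ^ 2 + q' + 1) * (q' ^ 4) ^ m)%:R
    = 2 * (x ^+ 2 + x + 1) * (x ^+ 4) ^+ m :> R.
  by rewrite !natrM !natrD !natrX.
by field.
Qed.

Import numFieldNormedType.Exports.

Lemma ball_volume2E (R : realType) (q n : nat) : (0 < q)%N -> (0 < n)%N ->
  (ball_volume q n 2)%:R =
    1 + (q%:R - 1) * n%:R + (q%:R - 1) ^+ 2 * (n%:R * (n%:R - 1) / 2) :> R.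
Proof.
move=> q_gt0 n_gt0; rewrite /ball_volume !big_nat_recr //= big_geq // add0n.
rewrite bin0 bin1 expn0 expn1 muln1 !natrD !natrM !natrB // expr2.
have <- : ('C(n, 2)%:R : R) * 2 = n%:R * (n%:R - 1).
  have -> : n%:R - 1 = (n - 1)%:R :> R by rewrite natrB.
  by rewrite -!natrM subn1 mulnC -mul_bin_diag bin1.
by rewrite mulfK.
Qed.

(* For [r = 2 t + 1] with [t = s + 2] the length is [c q ^ s], so the density is a
   quadratic polynomial in [q ^ - s]. *)
Lemma covering_density_cvg (R : realType) (q' : nat) : (1 < q')%N ->
  let x : R := q'%:R in
  let c : R := 2 * (x ^+ 2 + x + 1) * x ^+ 4 + 1 in
  ((fun t : nat => covering_density R (q' ^ 4) (code_length q' (2 * t + 1))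
                     (2 * t + 1) 2) @ \oo
   --> (x ^+ 4 - 1) ^+ 2 * c ^+ 2 / (2 * (x ^+ 4) ^+ 5))%classic.
Proof.
move=> q'_gt1 x c.
have x_gt1 : 1 < x by rewrite ltr1n.
have x_gt0 : 0 < x by rewrite (lt_trans ltr01).
pose Q := x ^+ 4; have Q_gt0 : 0 < Q by rewrite exprn_gt0.
have Q_gt1 : 1 < Q by rewrite exprn_egt1.
have QE : (q' ^ 4)%:R = Q by rewrite natrX.
(* Dropping [r = 1] and [r = 3] leaves the codimensions where the second summand of the length is
   [q ^ s]. *)
rewrite -(cvg_shiftn 2) /=.
pose A := (Q - 1) ^+ 2 * c ^+ 2 / (2 * Q ^+ 5).
pose B := ((Q - 1) * c - (Q - 1) ^+ 2 * c / 2) / Q ^+ 5.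
have -> : (fun s : nat => covering_density R (q' ^ 4)
      (code_length q' (2 * (s + 2) + 1)) (2 * (s + 2) + 1) 2)
    = (fun s : nat => A + (B + Q^-1 ^+ s / Q ^+ 5) * Q^-1 ^+ s).
  apply/funext => s; rewrite /covering_density.
  have nE : (code_length q' (2 * (s + 2) + 1))%:R = c * Q ^+ s.
    rewrite /code_length (_ : (_ - 3)./2 = s.+1); last lia.
    rewrite natrD natrM [((q' ^ 4) ^ s.+1)%:R]natrX [((q' ^ 4) ^ s)%:R]natrX.
    rewrite QE.
    have -> : (2 * (q' ^ 2 + q' + 1))%:R = 2 * (x ^+ 2 + x + 1) :> R.
      by rewrite natrM !natrD natrX.
    rewrite (_ : c = 2 * (x ^+ 2 + x + 1) * Q + 1) //.
    by rewrite [Q ^+ s.+1]exprS [RHS]mulrDl mul1r mulrA.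
  have n_gt0 : (0 < code_length q' (2 * (s + 2) + 1))%N.
    by apply: ltn_addr; rewrite !muln_gt0 !expn_gt0 (ltnW q'_gt1) addn1.
  have q_gt0 : (0 < q' ^ 4)%N by rewrite expn_gt0 ltnW.
  rewrite (ball_volume2E _ q_gt0 n_gt0) nE QE.
  rewrite (_ : (2 * (s + 2) + 1)%N = (5 + (s + s))%N); last lia.
  rewrite !exprD !exprVn /A /B.
  have : Q ^+ s != 0 by rewrite expf_neq0 // gt_eqF.
  have : Q != 0 by rewrite gt_eqF.
  by move: (Q ^+ s) => y Q0 y0; field; rewrite Q0 y0.
have z0 : ((fun s : nat => Q^-1 ^+ s) @ \oo --> (0 : R))%classic.
  by apply: cvg_expr; rewrite gtr0_norm ?invr_gt0 // invf_lt1.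
have : ((fun s : nat => A + (B + Q^-1 ^+ s / Q ^+ 5) * Q^-1 ^+ s) @ \oo
    --> A + (B + 0 / Q ^+ 5) * 0)%classic.
  apply: cvgD; first exact: cvg_cst.
  apply: cvgM => //; apply: cvgD; first exact: cvg_cst.
  by apply: cvgM => //; apply: cvg_cst.
by rewrite mulr0 addr0.
Qed.

Theorem theorem12 (R : realType) (q' q : nat) (hq' : prime_power q')
    (hq : q = (q' ^ 4)%N) (F : finFieldType) (hF : #|F| = q) :
  exists n : nat -> nat,
    (forall r : nat, odd r -> (3 <= r)%N ->
       (n r)%:R =
         (2 + 2 / q%:R `^ (1 / 4) + 2 / Num.sqrt q%:R)
           * q%:R `^ ((r%:R - 2) / 2)
         + (Num.floor (q%:R `^ ((r%:R - 5) / 2) : R))%:~R :> R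
       /\ exists C : {vspace 'rV[F]_(n r)}, covering_code r 2 C)
    /\
    (limn_einf (fun t : nat =>
        (covering_density R q (n (2 * t + 1)%N) (2 * t + 1) 2)%:E)
     < (2 + 4 / q%:R `^ (1 / 4) + 6 / Num.sqrt q%:R
          + 4 / (q%:R ^+ 3) `^ (1 / 4) - 2 / q%:R
          - 8 / (q%:R * q%:R `^ (1 / 4)))%:E)%E.
Proof.
rewrite {q}hq in hF *.
have q'_gt1 : (1 < q')%N.
  by case: hq' => p [e [p_pr e_gt0 ->]]; rewrite -(expn0 p) ltn_exp2l ?prime_gt1.
exists (code_length q'); split.
  move=> r r_odd r_ge3.
  have -> : r = (3 + 2 * (r - 3)./2)%N by lia.
  move: (_./2) => m; split; first exact: code_lengthE.
  have nE : code_length q' (3 + 2 * m) = (2 * (q' ^ 2 + q' + 1) * (q' ^ 4) ^ m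
      + (if m is m'.+1 then (q' ^ 4) ^ m' else 0))%N.
    by rewrite /code_length (_ : (_ - 3)./2 = m) //; lia.
  apply: (codes_exist hq' hF); rewrite hF nE; first exact: leq_addr.
  rewrite [leqRHS]mulnDl mul1n leq_add2l; case: m {nE} => // m.
  (* The extra summand [q^(m - 1)] is at most [q^m], the slack allowed in [codes_exist]. *)
  by rewrite leq_exp2l // -(expn0 q') ltn_exp2l.
have x_ge2 : 2 <= q'%:R :> R by rewrite ler_nat.
have x_ge0 : 0 <= q'%:R :> R by rewrite ler0n.
have x_neq0 : q'%:R != 0 :> R by rewrite pnatr_eq0 -lt0n ltnW.
have density_cvg := @covering_density_cvg R _ q'_gt1.
have limE : ((fun t : nat => (covering_density R (q' ^ 4)
    (code_length q' (2 * t + 1)) (2 * t + 1) 2)%:E) @ \oo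
  --> ((q'%:R ^+ 4 - 1) ^+ 2
    * (2 * (q'%:R ^+ 2 + q'%:R + 1) * q'%:R ^+ 4 + 1) ^+ 2
    / (2 * (q'%:R ^+ 4) ^+ 5) : R)%:E)%classic.
  by apply: cvg_EFin => //; apply: nearW.
(* The densities converge, so the lower limit is the limit. *)
rewrite is_cvg_limn_einfE; last by apply/cvg_ex; eexists; exact: limE.
rewrite (cvg_lim _ limE) //.
rewrite lte_fin natrX.
have -> : (q'%:R ^+ 4) `^ (1 / 4) = q'%:R :> R.
  by rewrite (@powR_fourth_nat _ _ x_ge2 _ 1) //; field.
have -> : Num.sqrt (q'%:R ^+ 4) = q'%:R ^+ 2 :> R.
  by rewrite (exprM _ 2 2) sqrtr_sqr ger0_norm // exprn_ge0.
have -> : ((q'%:R ^+ 4) ^+ 3) `^ (1 / 4) = q'%:R ^+ 3 :> R.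
  have x3_ge2 : 2 <= q'%:R ^+ 3 :> R.
    by apply: le_trans x_ge2 _; rewrite ler_eXnr // ler1n ltnW.
  (* Here [q^3] is the fourth power of [q'^3], which takes the place of [x]. *)
  by rewrite exprAC (@powR_fourth_nat _ _ x3_ge2 _ 1) //; field.
exact: density_limit_bound.
Qed.
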